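(* Let $T=(V,E,w)$ be a tree with non-negative edge weights $w$, let $d_T$ be its shortest-path metric, let $K=\{t_1,\dots,t_k\}\subseteq V$ be a set of terminals, and let $r\in V$ be an arbitrary vertex. Let $\pi$ be an ordering of the terminals by non-decreasing distance $d_T(r,\cdot)$ from $r$, with ties broken arbitrarily. Run the Graphic-Relaxed-Voronoi algorithm (described in the context) on input $(T,K,\pi)$ with all magnitudes equal to $3$, i.e. $R_1=\dots=R_k=3$, and let $T_K$ be the minor it returns. Then $T_K$ has distortion at most $8$, i.e. for all distinct terminals $t,t'\in K$, $$d_T(t,t')\le d_{T_K}(t,t')\le 8\cdot d_T(t,t').$$ Moreover, the algorithm can be implemented in time linear in the size of $T$.
   Context: For a weighted graph $G=(V,E,w)$ with terminal set $K$, let $d_G$ denote its shortest-path metric and $D(v)=\min_{t\in K} d_G(v,t)$ the distance from $v$ to its closest terminal. A partition $\{V_1,\dots,V_k\}$ of $V$ is a terminal partition if for each $i$, the induced subgraph $G[V_i]$ is connected and contains $t_i$. The minor induced by a terminal partition is obtained by contracting each $V_i$ into a single vertex (called $t_i$); it has an edge between $t_i$ and $t_j$ iff $G$ has an edge with one endpoint in $V_i$ and the other in $V_j$, and this edge gets weight $d_G(t_i,t_j)$. For a minor $M$ on vertex set $K$, $d_M$ is its shortest-path metric, and its distortion is $\max_{i\neq j} d_M(t_i,t_j)/d_G(t_i,t_j)$. Graphic-Relaxed-Voronoi algorithm: input a weighted graph $G=(V,E,w)$, terminals $K$, an ordering $\pi=(t_1,\dots,t_k)$ of $K$, and magnitudes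 $R_1,\dots,R_k\ge 1$. Initialize the set of unclustered vertices $V_\perp=V\setminus K$. For $j=1,\dots,k$ in order: build the cluster $V_j$ as follows. Set $V_j=\{t_j\}$, $U=\emptyset$, and $N=$ the set of neighbors of $t_j$ in $V_\perp$. While $N\neq\emptyset$: remove an arbitrary vertex $v$ from $N$; if $d_G(v,t_j)\le R_j\cdot D(v)$, add $v$ to $V_j$ and add to $N$ all neighbors of $v$ lying in $V_\perp\setminus(U\cup V_j)$; otherwise add $v$ to $U$. After the loop, set $V_\perp\leftarrow V_\perp\setminus V_j$. Finally return the minor induced by $V_1,\dots,V_k$ (these sets form a terminal partition). *)

(* Defs.v *)
From HB Require Import structures.
From mathcomp Require Import all_boot all_order all_algebra.
From mathcomp Require Import boolp classical_sets reals constructive_ereal ereal.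

Set Implicit Arguments.
Unset Strict Implicit.
Unset Printing Implicit Defensive.

Import Order.TTheory GRing.Theory Num.Theory.
Local Open Scope ring_scope.

(* The values of [gwt] on non-adjacent pairs are irrelevant. *)
Record wgraph (R : realType) (V : finType) := WGraph {
  gadj : rel V;
  gwt : V -> V -> R;
  gadj_sym : symmetric gadj;
  gadj_irr : irreflexive gadj;
  gwt_sym : forall u v, gwt u v = gwt v u;
  gwt_ge0 : forall u v, gadj u v -> 0 <= gwt u v }.

Definition edges (R : realType) (V : finType) (G : wgraph R V) : {set {set V}} :=
  [set [set p.1; p.2] | p : V * V & gadj G p.1 p.2].

Definition gsize (R : realType) (V : finType) (G : wgraph R V) : nat :=
  (#|V| + #|edges G|)%N.

Definition is_tree (R : realType) (V : finType) (G : wgraph R V) : Prop :=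
  (forall u v, connect (gadj G) u v) /\
  (forall c, ucycle (gadj G) c -> (size c < 3)%N).

Fixpoint walk_wt (R : realType) (V : finType) (G : wgraph R V) (u : V) (p : seq V) : R :=
  if p is v :: p' then gwt G u v + walk_wt G v p' else 0.

(* Extended-real valued: [+oo] between distinct connected components. *)
Definition dist (R : realType) (V : finType) (G : wgraph R V) (u v : V) : \bar R :=
  ereal_inf [set (walk_wt G u p)%:E
            | p in [set p : seq V | path (gadj G) u p /\ last u p = v]%classic]%classic.

(* The distance [D(v)] from [v] to its closest terminal. *)
Definition tdist (R : realType) (V : finType) (G : wgraph R V) (K : {set V}) (v : V) : \bar R :=
  ereal_inf [set dist G v t | t in [set t : V | t \in K]%classic]%classic.

Lemma dist_ge0 (R : realType) (V : finType) (G : wgraph R V) (u v : V) :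
  (0 <= dist G u v)%E.
Proof.
apply: le_ereal_inf_tmp => _ [p [+ _] <-]; rewrite lee_fin.
elim: p u => //= x p IH u /andP[ux xp].
by rewrite addr_ge0 ?IH // gwt_ge0.
Qed.

Lemma dist_sym (R : realType) (V : finType) (G : wgraph R V) (u v : V) :
  dist G u v = dist G v u.
Proof.
suff H a b : (dist G a b <= dist G b a)%E by apply/le_anti; rewrite !H.
have rcons_wt x p y : walk_wt G x (rcons p y) = walk_wt G x p + gwt G (last x p) y.
  by elim: p x => /= [|z p IH] x; rewrite ?addr0 ?add0r // IH addrA.
apply: le_ereal_inf_tmp => _ [p [+ +] <-].
elim: p a b => [|x p IH] a b /=.
  by move=> _ ->; apply: ereal_inf_lbound; exists [::].
move=> /andP[bx xp] pa.
suff [q [q1 q2 <-]] : exists q, [/\ path (gadj G) a q, last a q = b &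
    walk_wt G a q = gwt G b x + walk_wt G x p].
  by apply: ereal_inf_lbound; exists q.
elim: p b x bx xp pa {IH} => [|y p IH] b x bx /=.
  move=> _ <-; exists [:: b].
  by split=> //=; [rewrite gadj_sym bx | rewrite gwt_sym].
move=> /andP[xy yp] pa; have [q [q1 q2 q3]] := IH x y xy yp pa.
exists (rcons q b); split.
- by rewrite rcons_path q1 q2 gadj_sym.
- by rewrite last_rcons.
- by rewrite rcons_wt q2 q3 addrC (gwt_sym G x b).
Qed.

(* A terminal is an element of the subtype [{t | t \in K}]; a family of
   clusters [C] assigns to each terminal [t] its cluster [C t]. *)
Section Minor.
Variables (R : realType) (V : finType) (G : wgraph R V) (K : {set V}).
Variable C : {t : V | t \in K} -> {set V}.

Definition minor_adj : rel {t : V | t \in K} := fun t t' =>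
  (t != t') && [exists u in C t, exists v in C t', gadj G u v].

(* If [C] is a terminal partition and [t], [t'] are adjacent in the minor then
   [dist G t t'] is finite, so [fine] loses nothing. *)
Definition minor_wt (t t' : {t : V | t \in K}) : R :=
  fine (dist G (val t) (val t')).

Lemma minor_adj_sym : symmetric minor_adj.
Proof.
move=> t t'; rewrite /minor_adj eq_sym; congr (_ && _).
by apply/exists_inP/exists_inP => -[u Hu /exists_inP[v Hv uv]];
  exists v => //; apply/exists_inP; exists u => //; rewrite gadj_sym.
Qed.

Lemma minor_adj_irr : irreflexive minor_adj.
Proof. by move=> t; rewrite /minor_adj eqxx. Qed.

Lemma minor_wt_sym t t' : minor_wt t t' = minor_wt t' t.
Proof. by rewrite /minor_wt dist_sym. Qed.

Lemma minor_wt_ge0 t t' : minor_adj t t' -> 0 <= minor_wt t t'.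
Proof. by move=> _; rewrite fine_ge0 // dist_ge0. Qed.

Definition minor : wgraph R {t : V | t \in K} :=
  WGraph minor_adj_sym minor_adj_irr minor_wt_sym minor_wt_ge0.

End Minor.

Section GRV.
Variables (R : realType) (V : finType) (G : wgraph R V) (K : {set V}).

Definition nbrs (v : V) : {set V} := [set u | gadj G v u].

(* [grow t rho A C U N C']: the while loop building the cluster of [t] with
   magnitude [rho], when [A] is the set of unclustered vertices, can go from
   the values [C], [U], [N] of its variables to termination with the cluster
   [C']. The vertex extracted from [N] is arbitrary, whence a relation. *)
Inductive grow (t : V) (rho : R) (A : {set V}) :
    {set V} -> {set V} -> {set V} -> {set V} -> Prop :=
| grow_done (C U : {set V}) : grow t rho A C U finset.set0 C
| grow_accept (C U N C' : {set V}) (v : V) :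
    v \in N -> (dist G v t <= rho%:E * tdist G K v)%E ->
    grow t rho A (v |: C) U
      ((N :\ v) :|: (nbrs v :&: (A :\: (U :|: (v |: C))))) C' ->
    grow t rho A C U N C'
| grow_reject (C U N C' : {set V}) (v : V) :
    v \in N -> ~~ (dist G v t <= rho%:E * tdist G K v)%E ->
    grow t rho A C (v |: U) (N :\ v) C' ->
    grow t rho A C U N C'.

(* The outer loop, over the terminals still to be processed; [A] is the set of
   unclustered vertices. *)
Fixpoint grv_loop (mag : {t : V | t \in K} -> R) (A : {set V})
    (pi : seq {t : V | t \in K}) (C : {t : V | t \in K} -> {set V}) : Prop :=
  if pi is t :: pi' then
    grow (val t) (mag t) A [set val t] finset.set0 (nbrs (val t) :&: A) (C t) /\
    grv_loop mag (A :\: C t) pi' C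
  else True.

(* [C] is a possible family of clusters computed on input [(G, K, pi)] with
   magnitudes [mag]; the algorithm then returns [minor G C]. *)
Definition grv (mag : {t : V | t \in K} -> R)
    (pi : seq {t : V | t \in K}) (C : {t : V | t \in K} -> {set V}) : Prop :=
  grv_loop mag (~: K) pi C.

Definition ordering (pi : seq {t : V | t \in K}) : Prop :=
  uniq pi /\ forall t, t \in pi.

Definition ordered_from (r : V) (pi : seq {t : V | t \in K}) : Prop :=
  ordering pi /\
  sorted (fun s t => (dist G r (val s) <= dist G r (val t))%E) pi.

End GRV.

(* A unit-cost random access machine with real registers.  The memory consists
   of arrays of naturals and arrays of reals, named by naturals; a scalar
   variable is cell 0 of an array.  On naturals the only arithmetic is successor
   and predecessor, so the numbers handled grow by at most a constant (depending
   on the program) at each step: unit cost cannot be abused through huge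
   numbers.  On reals the machine can only add, subtract and compare. *)
Record store (R : realType) := Store {
  nmem : nat -> nat -> nat;
  rmem : nat -> nat -> R }.

Inductive nexp :=
| NLit (n : nat)
| NGet (a : nat) (i : nexp)
| NSucc (e : nexp)
| NPred (e : nexp).

Inductive rexp :=
| RZero
| RGet (a : nat) (i : nexp)
| RAdd (x y : rexp)
| RSub (x y : rexp).

Inductive bexp :=
| BLe (e f : nexp)
| BLeR (x y : rexp)
| BNot (b : bexp)
| BAnd (b c : bexp).

Inductive com :=
| Skip
| NSet (a : nat) (i e : nexp)
| RSet (a : nat) (i : nexp) (x : rexp)
| Seq (c d : com)
| If (b : bexp) (c d : com)
| While (b : bexp) (c : com).

Section Semantics.
Variable R : realType.
Implicit Types s : store R.

Fixpoint neval s (e : nexp) : nat :=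
  match e with
  | NLit n => n
  | NGet a i => nmem s a (neval s i)
  | NSucc e => (neval s e).+1
  | NPred e => (neval s e).-1
  end.

Fixpoint reval s (x : rexp) : R :=
  match x with
  | RZero => 0
  | RGet a i => rmem s a (neval s i)
  | RAdd x y => reval s x + reval s y
  | RSub x y => reval s x - reval s y
  end.

Fixpoint beval s (b : bexp) : bool :=
  match b with
  | BLe e f => (neval s e <= neval s f)%N
  | BLeR x y => reval s x <= reval s y
  | BNot b => ~~ beval s b
  | BAnd b c => beval s b && beval s c
  end.

Definition upd (T : Type) (m : nat -> nat -> T) (a i : nat) (x : T) : nat -> nat -> T :=
  fun a' i' => if (a' == a) && (i' == i) then x else m a' i'.

(* [exec c s s' m]: started in [s], [c] terminates in [s'] after [m] steps.
   An assignment or a test is one step: the expressions occurring in a program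
   have constant size, so this is up to a constant factor the number of
   elementary operations performed. *)
Inductive exec : com -> store R -> store R -> nat -> Prop :=
| exec_skip s : exec Skip s s 1
| exec_nset a i e s :
    exec (NSet a i e) s
      (Store (upd (nmem s) a (neval s i) (neval s e)) (rmem s)) 1
| exec_rset a i x s :
    exec (RSet a i x) s
      (Store (nmem s) (upd (rmem s) a (neval s i) (reval s x))) 1
| exec_seq c d s s1 s2 m1 m2 :
    exec c s s1 m1 -> exec d s1 s2 m2 -> exec (Seq c d) s s2 (m1 + m2)
| exec_if b c d s s1 m :
    exec (if beval s b then c else d) s s1 m -> exec (If b c d) s s1 m.+1
| exec_while_end b c s :
    ~~ beval s b -> exec (While b c) s s 1
| exec_while_step b c s s1 s2 m1 m2 :
    beval s b -> exec c s s1 m1 -> exec (While b c) s1 s2 m2 ->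
    exec (While b c) s s2 (m1 + m2).+1.

End Semantics.

Definition aN := 0%N.
Definition aK := 1%N.
Definition aOff := 2%N.
Definition aNbr := 3%N.
Definition aTerm := 4%N.
Definition aOutN := 5%N.
Definition aOutSrc := 6%N.
Definition aOutDst := 7%N.
Definition rLen := 0%N.
Definition rOutLen := 1%N.

Section IO.
Variables (R : realType) (V : finType).

Definition code (v : V) : nat := enum_rank v.

(* Input: the graph as adjacency lists, each in an arbitrary order and all
   stored contiguously (the list of [v] occupies the positions from
   [off (code v)] included to [off (code v).+1] excluded), and the terminals in
   the order [pi].  The rest of the memory is arbitrary. *)
Definition encodes (G : wgraph R V) (K : {set V})
    (pi : seq {t : V | t \in K}) (s : store R) : Prop :=
  let off := nmem s aOff in
  [/\ nmem s aN 0 = #|V|,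
      nmem s aK 0 = size pi,
      mkseq (nmem s aTerm) (size pi) = [seq code (val t) | t <- pi],
      off 0%N = 0%N /\ (forall i, (i < #|V|)%N -> (off i <= off i.+1)%N)
    & forall v : V,
        perm_eq [seq (nmem s aNbr l, rmem s rLen l)
                | l <- index_iota (off (code v)) (off (code v).+1)]
                [seq (code u, gwt G v u) | u <- enum (gadj G v)]].

(* Output: the list of the weighted edges of [M], each occurring exactly once,
   in one of its two orientations. *)
Definition outputs (K : {set V}) (M : wgraph R {t : V | t \in K}) (s : store R) : Prop :=
  exists E : seq ({t : V | t \in K} * {t : V | t \in K}),
    perm_eq [seq [set p.1; p.2] | p <- E] (enum (edges M)) /\
    mkseq (fun i => (nmem s aOutSrc i, nmem s aOutDst i, rmem s rOutLen i))
          (nmem s aOutN 0)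
    = [seq (code (val p.1), code (val p.2), gwt M p.1 p.2) | p <- E].

End IO.

(* Main.v *)
Require Import Defs.
From HB Require Import structures.
From mathcomp Require Import all_boot all_order all_algebra.
From mathcomp Require Import boolp classical_sets reals constructive_ereal ereal.
From mathcomp Require Import lra zify.
From mathcomp Require Import fintype finset.

(** Write [d] for the distance in the tree, [D v] for the distance from [v] to
    [K] and [c v] for the terminal whose cluster contains [v]; root the tree at
    [r].  On an edge from a parent [u] to a child [q] lying in different
    clusters, [c u] is processed before [c q] (unless [u] itself is a terminal),
    so [q] was refused by [c u]: [3 D q <= d q (c u)].  On the other hand some
    terminal nearest to [q] is processed no earlier than [c q], hence is at least
    as far from [r] as [c u].  Together, if [v] is the topmost vertex of the
    cluster of [c u], then [d v (c u) <= 2 d v q].  Hence, on the way up from a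
    terminal [t'], the detours to the successive cluster centres cost at most
    four times the length of the path, and
    [d_M (c v) t' <= d v (c v) + 5 d v t'] for every ancestor [v] of [t'].  At
    the lowest common ancestor [a] of [t] and [t'] this gives
    [d_M t t' <= 2 d a (c a) + 5 d t t'], where
    [d a (c a) <= 3 D a <= 3/2 d t t'].

    Each cluster is a connected component of the accepted unclustered vertices,
    whatever the order of exploration, so breadth-first searches compute all of
    them in linear time once [D] is known; [D] is obtained by relaxing the edges
    of a rooted tree upwards and then downwards.  The edges of the minor are in
    bijection with the tree edges joining different clusters. *)

Set Implicit Arguments.
Unset Strict Implicit.
Unset Printing Implicit Defensive.

Import Order.TTheory GRing.Theory Num.Theory.
Local Open Scope ring_scope.

(* [constructive_ereal] exports another [code]. *)
Local Notation code := Defs.code.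

(** * Distances in trees *)

(** Real values allow linear arithmetic; in a connected graph [distE] shows that [fine] loses
    nothing. *)
Definition rdist (R : realType) (V : finType) (G : wgraph R V) (u v : V) : R :=
  fine (dist G u v).

Section Metric.
Variables (R : realType) (V : finType) (G : wgraph R V).
Local Notation d := (rdist G).

Lemma dist_le_walk u p : path (gadj G) u p ->
  (dist G u (last u p) <= (walk_wt G u p)%:E)%E.
Proof. by move=> up; apply: ereal_inf_lbound; exists p. Qed.

Lemma rdistC u v : d u v = d v u.
Proof. by rewrite /rdist dist_sym. Qed.

Lemma rdist_ge0 u v : 0 <= d u v.
Proof. by rewrite fine_ge0 // dist_ge0. Qed.

Lemma rdist0 u : d u u = 0.
Proof.
have /andP[] : (0 <= dist G u u <= 0)%E.
  by rewrite dist_ge0 /=; apply: (@dist_le_walk u [::]).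
by rewrite /rdist => h1 h2; have/le_anti -> : (dist G u u <= 0 <= dist G u u)%E by rewrite h2 h1.
Qed.

Hypothesis conn : forall u v, connect (gadj G) u v.

Lemma distE u v : dist G u v = (d u v)%:E.
Proof.
rewrite /rdist fineK //; have /connectP[p up ->] := conn u v.
rewrite ge0_fin_numE ?dist_ge0 //.
by apply: le_lt_trans (dist_le_walk up) _; rewrite ltry.
Qed.

Lemma rdist_le_walk u p : path (gadj G) u p -> d u (last u p) <= walk_wt G u p.
Proof. by move=> up; rewrite -lee_fin -distE dist_le_walk. Qed.

Lemma le_rdist L u v :
  (forall p, path (gadj G) u p -> last u p = v -> L <= walk_wt G u p) -> L <= d u v.
Proof.
move=> H; rewrite -lee_fin -distE; apply: le_ereal_inf_tmp => _ [p [up pv] <-].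
by rewrite lee_fin H.
Qed.

Lemma rdist_step u v x : gadj G u v -> d u x <= gwt G u v + d v x.
Proof.
move=> uv; rewrite -lerBlDl; apply: le_rdist => p vp <-.
by rewrite lerBlDl; apply: (@rdist_le_walk u (v :: p)); rewrite /= uv.
Qed.

Lemma rdist_triangle y x z : d x z <= d x y + d y z.
Proof.
rewrite -lerBlDr; apply: le_rdist => p + <-.
elim: p x => /= [|v p IH] x; first by rewrite subrr.
move=> /andP[xv vp]; have := IH _ vp; have := rdist_step z xv; lra.
Qed.

Lemma rdist_edge u v : gadj G u v -> d u v <= gwt G u v.
Proof. by move=> uv; have := rdist_step v uv; rewrite rdist0 addr0. Qed.

End Metric.

Section Tree.
Variables (R : realType) (V : finType) (G : wgraph R V).
Hypothesis treeG : is_tree G.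
Local Notation d := (rdist G).
Let conn : forall u v, connect (gadj G) u v := proj1 treeG.

Definition del_edge (q u : V) : rel V := fun x y =>
  gadj G x y && ~~ ((x == q) && (y == u) || (x == u) && (y == q)).

(** For an edge of a tree this is one of the two components left when the edge is deleted. Rooting
    is expressed through it: for an edge, [side u q r] says that [u] is the parent of [q] when the
    tree is rooted at [r]. *)
Definition side (q u : V) : pred V := connect (del_edge q u) q.

Lemma del_edgeC q u : del_edge q u =2 del_edge u q.
Proof. by move=> x y; rewrite /del_edge orbC. Qed.

Lemma del_edge_sym q u : connect_sym (del_edge q u).
Proof.
apply: sym_connect_sym => x y; rewrite /del_edge gadj_sym; congr (_ && ~~ _).
by rewrite orbC; congr (_ || _); rewrite andbC.
Qed.

(** A simple path from [q] to [u] avoiding the edge would close up with it to a cycle. [is_tree]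
    excludes only cycles of length at least 3, so paths with no edge or one edge are treated apart:
    they contradict irreflexivity and the deletion of the edge. *)
Lemma bridge q u : gadj G q u -> ~~ side q u u.
Proof.
move=> qu; apply/negP => /connectP[p0 qp0 e0].
case/shortenP: qp0 e0 => p qp up _ e.
have gp : path (gadj G) q p by apply: sub_path qp => x y /andP[].
have : ucycle (gadj G) (q :: p).
  by rewrite /ucycle up andbT /= rcons_path gp -e gadj_sym.
move=> /(proj2 treeG); case: p {up gp} qp e => [|x [|//]] //=.
  by move=> _ /= e; move: qu; rewrite e gadj_irr.
by move=> /= + e; rewrite -e /del_edge !eqxx andbF.
Qed.

Lemma side_excl q u x : gadj G q u -> side q u x -> ~~ side u q x.
Proof.
move=> qu qx; apply/negP; rewrite /side -(eq_connect (del_edgeC q u)) => ux.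
move/negP: (bridge qu); apply; apply: connect_trans qx _.
by rewrite del_edge_sym.
Qed.

Lemma side_neq q u x : gadj G q u -> side q u x -> x != u.
Proof.
by move=> qu qx; apply/eqP => e; have := side_excl qu qx; rewrite e /side connect0.
Qed.

Lemma del_edge_path q u x p : path (gadj G) x p ->
  (u \notin x :: p) || (q \notin x :: p) -> path (del_edge q u) x p.
Proof.
elim: p x => //= y p IH x /andP[xy yp] av.
rewrite IH //; last first.
  by move: av; rewrite !(inE, negb_or) => /orP[/and3P[_ -> ->]|/and3P[_ -> ->]]; rewrite ?orbT.
rewrite /del_edge xy andbT /=; move: av; rewrite !(inE, negb_or).
rewrite !(eq_sym u) !(eq_sym q).
by move=> /orP[] /and3P[/negbTE-> /negbTE-> _]; rewrite ?andbF.
Qed.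

Lemma side_path q u x p y : path (gadj G) x p ->
  (u \notin x :: p) || (q \notin x :: p) -> side q u x -> y \in x :: p ->
  side q u y.
Proof.
move=> xp av qx yp; apply: connect_trans qx _.
exact: (path_connect (del_edge_path xp av)).
Qed.

(** A walk from one side to the other must use the edge; following it up to the first step from [q]
    to [u] bounds its weight from below by the three terms. *)
Lemma rdist_cut q u x y : gadj G q u -> side q u x -> side u q y ->
  d x y = d x q + gwt G q u + d u y.
Proof.
move=> qu qx uy; apply/le_anti/andP; split.
  have := rdist_triangle conn q x y; have := rdist_step conn y qu; lra.
apply: le_rdist => // p; elim: p x qx => [|z p IH] x qx /=.
  by move=> _ e; move: uy; rewrite -e => /(side_excl (etrans (gadj_sym G u q) qu))/negP.
move=> /andP[xz zp] e; case: (boolP ((x == q) && (z == u))) => [/andP[/eqP xq /eqP zu]|ne].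
  subst x z; rewrite rdist0 add0r lerD2l -e; exact: rdist_le_walk.
have qz : side q u z.
  apply: (connect_trans qx (connect1 _)); rewrite /del_edge xz negb_or ne andTb negb_and.
  by rewrite (side_neq qu qx).
have := IH _ qz zp e; have := rdist_step conn q xz; lra.
Qed.

(** Every edge of a simple path separates its start from the rest of the path, so [rdist_cut] peels
    the edges off one by one. *)
Lemma walk_wt_upath x p : path (gadj G) x p -> uniq (x :: p) ->
  walk_wt G x p = d x (last x p).
Proof.
elim: p x => [|z p IH] x /=; first by rewrite rdist0.
move=> /andP[xz zp] /andP[xnz uz]; rewrite (IH _ zp uz) (rdist_cut xz (x := x)).
- by rewrite rdist0 add0r.
- exact: connect0.
- by apply: (side_path (x := z) zp); rewrite ?xnz ?mem_last // ?[side _ _ _]connect0.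
Qed.

Lemma exists_upath x y : exists p, [/\ path (gadj G) x p, uniq (x :: p) & last x p = y].
Proof.
have /connectP[p0 xp0 ->] := conn x y.
by case/shortenP: xp0 => p xp up _; exists p.
Qed.

(* [a] is the lowest common ancestor of [t] and [t'] in the tree rooted at
   [r]. *)
Lemma exists_apex r t t' p p' :
  path (gadj G) t p -> uniq (t :: p) -> last t p = r ->
  path (gadj G) t' p' -> uniq (t' :: p') -> last t' p' = r ->
  exists a, [/\ a \in t :: p, a \in t' :: p' & d t t' = d t a + d a t'].
Proof.
move=> tp up er tp' up' er'; elim: p t tp up er => [|z p IH] t.
  move=> _ _ /= ->; exists r; rewrite rdist0 add0r; split=> //.
    by rewrite inE.
  by rewrite -er' mem_last.
move=> /= /andP[tz zp] /andP[tnz uz] er.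
have [tin|tnin] := boolP (t \in t' :: p').
  by exists t; rewrite tin rdist0 add0r; split => //; rewrite inE eqxx.
have [a [az ap' e]] := IH z zp uz er.
exists a; split=> //; first by rewrite inE az orbT.
have rz : side z t r.
  by apply: (side_path (x := z) zp); rewrite ?tnz //= ?[side _ _ _]connect0 // -er mem_last.
(* The path from [t'] to [r] misses [t], hence survives the deletion of the edge and lies on the
   same side as [r]. *)
have Sp y : y \in t' :: p' -> side z t y.
  move=> yp'; apply: connect_trans rz _; rewrite del_edge_sym.
  have h w : w \in t' :: p' -> connect (del_edge z t) t' w.
    by apply: path_connect; apply: del_edge_path; rewrite ?tnin.
  apply: (@connect_trans _ _ t'); first by rewrite del_edge_sym h.
  by apply: h; rewrite -er' mem_last.
have tt : side t z t by apply: connect0.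
rewrite (rdist_cut tz tt (Sp _ ap')) (rdist_cut tz tt (Sp t' (mem_head _ _))).
by rewrite rdist0 e; lra.
Qed.

End Tree.

(** * The clusters of the algorithm *)

Section Grow.
Variables (R : realType) (V : finType) (G : wgraph R V) (K : {set V}).
Variables (t : V) (rho : R) (A : {set V}).

Definition accepts (v : V) : bool := (dist G v t <= rho%:E * tdist G K v)%E.

(** Only the target of a step is tested, so that the start [t] is exempt from both conditions. *)
Definition grow_rel : rel V := fun x y => [&& gadj G x y, y \in A & accepts y].

Definition component : {set V} := [set v | connect grow_rel t v].

(** Once [N] is empty, the last two clauses make [C] closed under [grow_rel], while the first keeps
    it inside the component; so every order of extraction yields the same cluster. *)
Definition grow_inv (C U N : {set V}) : Prop :=
  [/\ C \subset component, t \in C,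
      forall v, v \in N -> v \in A /\ exists2 x, x \in C & gadj G x v,
      forall v, v \in U -> ~~ accepts v
    & forall x y, x \in C -> gadj G x y -> y \in A -> [|| y \in C, y \in U | y \in N]].

Lemma grow_inv_component C U N C' : grow G K t rho A C U N C' ->
  grow_inv C U N -> C' = component.
Proof.
elim=> {C U N C'} [C U [Cc tC _ UP NP]|C U N C' v vN acc _ IH [Cc tC NA UP NP]
    |C U N C' v vN rej _ IH [Cc tC NA UP NP]].
- apply/eqP; rewrite eqEsubset Cc; apply/fintype.subsetP => x; rewrite inE => /connectP[p tp ->].
  elim: p t tC tp => //= y p IH x0 x0C /andP[/and3P[x0y yA yacc] yp].
  apply: IH yp; have := NP _ _ x0C x0y yA; rewrite inE orbF => /orP[//|/UP].
  by rewrite yacc.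
- apply: IH; split.
  + apply/fintype.subsetP => x /setU1P[->|/(fintype.subsetP Cc)//].
    have [vA [y yC yv]] := NA _ vN; have := fintype.subsetP Cc _ yC.
    rewrite !inE => ty; apply: connect_trans ty (connect1 _).
    by apply/and3P.
  + by rewrite !inE tC orbT.
  + move=> x; rewrite !inE => /orP[/andP[_ /NA[xA [y yC yx]]]|/andP[vx /andP[_ xA]]].
      by split=> //; exists y => //; rewrite !inE yC orbT.
    by split=> //; exists v => //; rewrite !inE eqxx.
  + exact: UP.
  + move=> x y; rewrite !inE => /orP[/eqP->|xC] xy yA; rewrite ?xy yA.
      by case: (y == v); case: (y \in C); case: (y \in U); rewrite ?orbT.
    have := NP _ _ xC xy yA.
    by case: (y == v) => //=; case: (y \in C) => //=; case: (y \in U) => //= ->.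
- apply: IH; split=> //.
  + by move=> x; rewrite !inE => /andP[_ /NA].
  + by move=> x; rewrite !inE => /orP[/eqP->|/UP].
  + move=> x y xC xy yA; have := NP _ _ xC xy yA; rewrite !inE.
    by case: (y == v) => //=; rewrite ?orbT.
Qed.

(** Termination: each iteration moves a new vertex into [C :|: U], so the complement shrinks. *)
Lemma grow_exists (C U N : {set V}) : (forall v, v \in N -> v \notin C :|: U) ->
  exists C', grow G K t rho A C U N C'.
Proof.
have [n] := ubnP #|~: (C :|: U)|; elim: n C U N => // n IH C U N; rewrite ltnS => le_n NP.
have [->|[v vN]] := set_0Vmem N; first by exists C; apply: grow_done.
have vnew := NP _ vN.
have lt v' (X : {set V}) : v' \notin C :|: U -> v' \in X -> C :|: U \subset X -> (#|~: X| < n)%N.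
  move=> v'n v'X CUX; apply: leq_trans le_n; apply: proper_card.
  rewrite finset.properC; apply/properP; split=> //; by exists v'.
have [acc|rej] := boolP (accepts v).
  have [||C' gC'] := IH (v |: C) U ((N :\ v) :|: (nbrs G v :&: (A :\: (U :|: (v |: C))))).
  - by apply: lt vnew _ _; [rewrite !inE eqxx|apply: finset.setSU; apply: subsetUr].
  - move=> x; rewrite !inE => /orP[/andP[/negbTE-> /NP]|]; first by rewrite !inE.
    by rewrite orbC => /and3P[_ + _].
  - by exists C'; apply: grow_accept gC'.
have [||C' gC'] := IH C (v |: U) (N :\ v).
- by apply: lt vnew _ _; [rewrite !inE eqxx orbT|apply: finset.setUS; apply: subsetUr].
- by move=> x; rewrite !inE => /andP[/negbTE-> /NP]; rewrite !inE.
- by exists C'; apply: grow_reject gC'.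
Qed.

(** The invariant makes the result unique and [grow_exists] provides a run, so the nondeterministic
    loop becomes a closed formula. *)
Lemma growP C' : t \notin A ->
  grow G K t rho A [set t] finset.set0 (nbrs G t :&: A) C' <-> C' = component.
Proof.
move=> tA.
have inv : grow_inv [set t] finset.set0 (nbrs G t :&: A).
  split.
  - by rewrite sub1set inE connect0.
  - by rewrite set11.
  - move=> v; rewrite !inE => /andP[tv vA]; split=> //; exists t => //; exact: set11.
  - by move=> v; rewrite inE.
  - by move=> x y; rewrite !inE => /eqP-> -> ->; rewrite orbT.
split=> [/grow_inv_component|->]; first exact.
have [|C2 g2] := @grow_exists [set t] finset.set0 (nbrs G t :&: A).
  by move=> v; rewrite !inE orbF => /andP[_ vA]; apply: contraNneq tA => <-.
by rewrite -(grow_inv_component g2 inv).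
Qed.

End Grow.

(** * Distance to the nearest terminal *)

Section TerminalDistance.
Variables (R : realType) (V : finType) (G : wgraph R V) (K : {set V}).
Hypothesis conn : forall u v, connect (gadj G) u v.
Local Notation d := (rdist G).

Definition rtdist (v : V) : R := fine (tdist G K v).

Lemma tdist_attained v t0 : t0 \in K ->
  exists s, [/\ s \in K, tdist G K v = (d v s)%:E & forall t, t \in K -> d v s <= d v t].
Proof.
move=> t0K; case: (Order.TotalTheory.arg_minP (d v) t0K) => s sK smin.
exists s; split=> //; apply/le_anti/andP; split.
  by apply: ereal_inf_lbound; exists s => //=; rewrite distE.
by apply: le_ereal_inf_tmp => _ [t /= tK <-]; rewrite distE // lee_fin smin.
Qed.

Lemma rtdist_attained v t0 : t0 \in K -> exists2 s, s \in K & rtdist v = d v s.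
Proof. by move=> /(tdist_attained v)[s [sK e _]]; exists s; rewrite // /rtdist e. Qed.

Lemma rtdist_le v t : t \in K -> rtdist v <= d v t.
Proof. by move=> tK; have [s [_ e h]] := tdist_attained v tK; rewrite /rtdist e h. Qed.

Lemma rtdist_step u v t0 : t0 \in K -> gadj G u v -> rtdist u <= gwt G u v + rtdist v.
Proof.
move=> t0K uv; have [s sK ->] := rtdist_attained v t0K.
exact: le_trans (rtdist_le u sK) (rdist_step conn s uv).
Qed.

Lemma rtdist_term t : t \in K -> rtdist t = 0.
Proof.
move=> tK; apply/le_anti; have := rtdist_le t tK; rewrite rdist0 => -> /=.
by have [s _ ->] := rtdist_attained t tK; rewrite rdist_ge0.
Qed.

Lemma acceptsE t rho v : t \in K -> accepts G K t rho v = (d v t <= rho * rtdist v).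
Proof.
move=> tK; rewrite /accepts /rtdist; have [s [_ -> _]] := tdist_attained v tK.
by rewrite distE // -EFinM lee_fin.
Qed.

End TerminalDistance.

Section Loop.
Variables (R : realType) (V : finType) (G : wgraph R V) (K : {set V}).
Local Notation S := {t : V | t \in K}.
Variables (mag : S -> R).

Definition clustered (C : S -> {set V}) (s : seq S) : {set V} :=
  [set v | has (fun t => v \in C t) s].

(** Replaces the changing set of unclustered vertices by one described through the earlier clusters,
    so that each cluster can be studied alone. *)
Lemma grv_loopP (A : {set V}) (pi : seq S) (C : S -> {set V}) : [disjoint K & A] ->
  grv_loop G mag A pi C <->
  forall p1 t p2, pi = p1 ++ t :: p2 ->
    C t = component G K (val t) (mag t) (A :\: clustered C p1).
Proof.
elim: pi A => [|t pi IH] A disj; first by split=> // _ [].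
have tA : val t \notin A by rewrite (disjointFr disj) ?(valP t).
have disj' : [disjoint K & A :\: C t].
  by apply: disjointWr disj; apply: subsetDl.
have cl0 B : B :\: clustered C [::] = B by apply/setP => v; rewrite !inE.
have clS B p : B :\: C t :\: clustered C p = B :\: clustered C (t :: p).
  by apply/setP => v; rewrite !inE /= negb_or andbA [(v \notin _) && _]andbC.
rewrite /= (growP _ _ _ _ tA) (IH _ disj'); split=> [[h1 h2] [|t1 p1] t' p2 /= []|h].
- by move=> <- _; rewrite cl0.
- by move=> <- e; rewrite (h2 _ _ _ e) clS.
split=> [|p1 t' p2 e]; first by rewrite (h [::] t pi) ?cl0.
by rewrite (h (t :: p1) t' p2) ?e // clS.
Qed.

End Loop.

(** * Distortion *)

Lemma grvE (R : realType) (V : finType) (G : wgraph R V) (K : {set V})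
    (mag : {t : V | t \in K} -> R) pi C : ordering pi ->
  grv G mag pi C <-> forall t, C t =
    component G K (val t) (mag t) (~: K :\: clustered C (take (index t pi) pi)).
Proof.
move=> [upi mem_pi]; rewrite /grv grv_loopP ?disjoint_setI0 ?setICr //; last first.
  by rewrite -setI_eq0 setICr.
split=> [h t|h p1 t p2 e].
  apply: (h _ _ (drop (index t pi).+1 pi)).
  have it : (index t pi < size pi)%N by rewrite index_mem.
  by rewrite -[LHS](cat_take_drop (index t pi)) (drop_nth t it) nth_index.
rewrite h; move: upi; rewrite e cat_uniq /= negb_or => /and3P[_ /andP[tp1 _] _].
by rewrite index_cat (negbTE tp1) /= eqxx addn0 take_size_cat.
Qed.

Section Clusters.
Variables (R : realType) (V : finType) (G : wgraph R V) (K : {set V}).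
Hypothesis treeG : is_tree G.
Local Notation d := (rdist G).
Local Notation D := (rtdist G K).
Local Notation S := {t : V | t \in K}.
Let conn : forall u v, connect (gadj G) u v := proj1 treeG.
Variables (pi : seq S) (C : S -> {set V}).
Hypothesis ord_pi : ordering pi.
Hypothesis grvC : grv G (fun=> 3) pi C.
Local Notation idx := (index^~ pi).

Let CE : forall t, C t =
  component G K (val t) 3 (~: K :\: clustered C (take (idx t) pi)).
Proof. exact/grvE. Qed.

Lemma clustered_takeP v a :
  v \in clustered C (take (idx a) pi) -> exists2 b, (idx b < idx a)%N & v \in C b.
Proof.
rewrite inE => /hasP[b bpi vb]; exists b => //; apply: index_ltn bpi.
Qed.

Lemma in_clustered_take v a b :
  (idx b < idx a)%N -> v \in C b -> v \in clustered C (take (idx a) pi).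
Proof.
move=> lt_ba vb; rewrite inE; apply/hasP; exists b => //.
by rewrite in_take // (proj2 ord_pi).
Qed.

Lemma terminal_in_cluster a : val a \in C a.
Proof. by rewrite CE inE connect0. Qed.

Lemma cluster_cases v a : v \in C a -> v = val a \/
  [/\ v \notin K, forall b, (idx b < idx a)%N -> v \notin C b & d v (val a) <= 3 * D v].
Proof.
rewrite CE inE => /connectP[p]; case/lastP: p => [_ ->|p z]; first by left.
rewrite rcons_path last_rcons => /andP[_ /and3P[_ zA zacc]] ->; right.
move: zA; rewrite !in_setD in_setC => /andP[zncl zK]; split=> //.
  by move=> b ba; apply: contra zncl; apply: in_clustered_take.
by rewrite -acceptsE // (valP a).
Qed.

Lemma cluster_le v a : v \in C a -> d v (val a) <= 3 * D v.
Proof.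
move=> /cluster_cases[->|[]//]; rewrite rdist0 rtdist_term ?mulr0 //; exact: valP a.
Qed.

Lemma cluster_uniq v a b : v \in C a -> v \in C b -> a = b.
Proof.
wlog : a b / (idx a < idx b)%N.
  move=> H va vb; case: (ltngtP (idx a) (idx b)) => [/H|/H|]; first exact.
    by move=> h; rewrite h.
  move=> /(congr1 (nth a pi)).
  by rewrite !nth_index ?(proj2 ord_pi).
move=> ab va /cluster_cases[vb|[vK /(_ _ ab)]]; last by rewrite va.
case: (cluster_cases va) => [vav|[]]; first by apply: val_inj; rewrite -vav.
by rewrite vb (valP b).
Qed.

(** The growth path from the terminal to [x] stays in the cluster, hence avoids [u] and survives the
    deletion of an edge at [u]. *)
Lemma cluster_connect q u x a : u \notin C a -> x \in C a ->
  connect (del_edge G q u) (val a) x.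
Proof.
move=> ua; rewrite CE inE => /connectP[p ap ->].
apply: (path_connect _ (mem_last _ _)); apply: del_edge_path.
  by apply: sub_path ap => y z /and3P[].
apply/orP; left; apply: contra ua => up; rewrite CE inE.
exact: (path_connect ap up).
Qed.

Lemma cluster_side q u a : q \in C a -> u \notin C a -> side G q u (val a).
Proof. by move=> qa ua; rewrite /side del_edge_sym cluster_connect. Qed.

(** When the turn of [a] comes, [y] either already belongs to an earlier cluster or is available and
    accepted, and then the search of [a] reaches it from [x]. *)
Lemma cluster_max x y a : x \in C a -> gadj G x y -> y \notin K ->
  d y (val a) <= 3 * D y -> exists2 b, (idx b <= idx a)%N & y \in C b.
Proof.
move=> xa xy yK le; case: (boolP (y \in clustered C (take (idx a) pi))) => [|ncl].
  by case/clustered_takeP=> b /ltnW ? ?; exists b.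
exists a => //; move: xa; rewrite CE !inE => ax; apply: connect_trans ax (connect1 _).
rewrite /grow_rel xy !inE yK andbT acceptsE ?(valP a) // le andbT.
by move: ncl; rewrite inE.
Qed.

(** Induction along a shortest path from [v] to a nearest terminal. If the next vertex [x] lies in
    the cluster of [b], then, [w] being the weight of the edge, [d v b <= w + 3 D x <= 3 (w + D x) =
    3 D v]. So [b] would accept [v], and [v] is clustered no later than by [b]. *)
Lemma cover (t0 : S) v :
  exists s b : S, [/\ D v = d v (val s), v \in C b & (idx b <= idx s)%N].
Proof.
have [s sK Dv] := rtdist_attained conn v (valP t0).
have [p [vp up ps]] := exists_upath treeG v s.
move: Dv; rewrite -ps -walk_wt_upath // => Dv; rewrite -ps in sK; move: vp sK Dv {up ps}.
have base u : u \in K ->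
    exists s b : S, [/\ D u = d u (val s), u \in C b & (idx b <= idx s)%N].
  move=> uK; pose s' : S := Sub u uK; exists s', s'; split=> //.
    by rewrite rtdist_term // SubK rdist0.
  exact: (terminal_in_cluster s').
elim: p v => [|x p IH] v /=; first by move=> _ vK _; apply: base.
move=> /andP[vx xp] lK Dv.
case: (boolP (v \in K)) => [/base//|vK].
have Dx : walk_wt G x p = D x.
  apply/le_anti/andP; split; first by have := rtdist_step conn lK vx; lra.
  by apply: le_trans (rtdist_le conn x lK) (rdist_le_walk conn xp).
have [s' [b [Ds xb bs]]] := IH x xp lK (esym Dx).
have := rdist_step conn (val s') vx; have := rtdist_le conn v (valP s').
rewrite Dv Dx Ds => h1 h2; have Dvs : D v = d v (val s') by lra.
have [|c cb vc] := cluster_max xb (etrans (gadj_sym G x v) vx) vK.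
  have := rdist_step conn (val b) vx; have := cluster_le xb; have := gwt_ge0 vx; lra.
by exists s', c; split=> //; [lra|apply: leq_trans cb bs].
Qed.

Lemma cover_cluster (t0 : S) v : exists a, v \in C a.
Proof. by have [_ [a [_ va _]]] := cover t0 v; exists a. Qed.

(** A path of the tree projects to a walk of the minor, since consecutive vertices lie in equal or
    adjacent clusters. *)
Lemma minor_connect a b : connect (gadj (minor G C)) a b.
Proof.
have /connectP[p] := conn (val a) (val b).
move: (val a) (terminal_in_cluster a) => x xa.
elim: p x a xa => [|y p IH] x a xa /=.
  by move=> _ e; rewrite (cluster_uniq xa (_ : x \in C b)) // -e terminal_in_cluster.
move=> /andP[xy yp] e; have [c yc] := cover_cluster a y.
apply: connect_trans (IH y c yc yp e).
have [->|ac] := eqVneq a c; first exact: connect0.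
apply: connect1; rewrite /= /minor_adj ac; apply/exists_inP; exists x => //.
by apply/exists_inP; exists y.
Qed.

Lemma minor_edge_le u q a b : u \in C a -> q \in C b -> a != b -> gadj G q u ->
  rdist (minor G C) a b <= d (val a) u + gwt G q u + d q (val b).
Proof.
move=> ua qb ab qu; apply: (@le_trans _ _ (d (val a) (val b))).
  apply: (rdist_edge minor_connect); rewrite /= /minor_adj ab; apply/exists_inP.
  by exists u => //; apply/exists_inP; exists q; rewrite // gadj_sym.
have uq : gadj G u q by rewrite gadj_sym.
have := rdist_triangle conn u (val a) (val b).
have := rdist_step conn (val b) uq; rewrite gwt_sym; lra.
Qed.

Section Rooted.
Variable r : V.
Hypothesis sorted_pi :
  sorted (fun s t => (dist G r (val s) <= dist G r (val t))%E) pi.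
Local Notation M := (minor G C).

Lemma rdist_idx s t : (idx s <= idx t)%N -> d r (val s) <= d r (val t).
Proof.
move=> st; rewrite -lee_fin -!(distE conn).
have := sorted_leq_nth _ _ s sorted_pi; move=> h.
have := h _ _ (idx s) (idx t).
rewrite !inE !index_mem !(proj2 ord_pi) !nth_index ?(proj2 ord_pi) //; apply=> //.
by move=> y x z; apply: le_trans.
Qed.

(** Suppose [u] is not a terminal. If [b] came no later than [a], then [b] refused [u], so
    [d u b > 3 D u >= d u a]; as [b] lies below [u], it would be farther from [r] than [a], against
    the order. Hence [a] comes first, and [q] escaped it by being refused, unless [q] is a terminal,
    where the bound is trivial. *)
Lemma exit_edge q u a b : gadj G q u -> side G u q r -> q \in C b -> u \in C a ->
  a != b -> u = val a \/ (idx a < idx b)%N /\ 3 * D q <= d q (val a).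
Proof.
move=> qu ru qb ua ab.
have ub : u \notin C b.
  by apply: contra ab => ub; apply/eqP; apply: cluster_uniq ua ub.
have bq := cluster_side qb ub.
have uq : gadj G u q by rewrite gadj_sym.
have uu : side G u q u by apply: connect0.
have rb := rdist_cut treeG uq ru bq; have ub' := rdist_cut treeG uq uu bq.
rewrite rdist0 in ub'.
case: (cluster_cases ua) => [->|[uK _ _]]; first by left.
right; have lt_ab : (idx a < idx b)%N.
  rewrite ltnNge; apply/negP => ba.
  have lt_ub : 3 * D u < d u (val b).
    rewrite ltNge; apply/negP => /(cluster_max qb qu uK)[c cb uc].
    rewrite (cluster_uniq uc ua) in cb; have e : idx a = idx b.
      by apply/eqP; rewrite eqn_leq cb.
    move: ab; rewrite -(nth_index a (proj2 ord_pi a)) e nth_index ?(proj2 ord_pi) //.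
    by rewrite eqxx.
  have := rdist_idx ba; have := rdist_triangle conn u r (val a); have := cluster_le ua.
  lra.
split=> //; case: (boolP (q \in K)) => [qK|qK].
  by rewrite rtdist_term // mulr0 rdist_ge0.
rewrite leNgt; apply/negP => /ltW/(cluster_max ua uq qK)[c ca qc].
by move: ca; rewrite (cluster_uniq qc qb) leqNgt lt_ab.
Qed.

(* The charging argument: going up from [t'] towards the root, the detours
   [d u (val a)] made at the exits from the clusters are paid for by the parts
   of the path below them. *)
Definition last_exit (t' : S) (s : seq V) (v : V) (a : S) : Prop :=
  a = t' \/ exists u q b, [/\ [/\ u \in C a, q \in C b, a != b, gadj G q u & side G u q r],
    u \in s, d v (val t') = d v u + gwt G q u + d q (val t'), d r u = d r v + d v u
    & rdist M b t' + d (val b) q <= 5 * d q (val t')].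

(** Going from [a] to [u] costs at most [d v a + d v u]; everything below [q] is already paid for by
    the last inequality of [last_exit]. *)
Lemma last_exit_le t' s v a : v \in C a -> last_exit t' s v a ->
  rdist M a t' <= d v (val a) + 5 * d v (val t').
Proof.
move=> va [->|[u [q [b [[ua qb ab qu ru] _ e1 e2 F]]]]].
  by rewrite rdist0; have := rdist_ge0 G v (val t'); lra.
have := minor_edge_le ua qb ab qu; have := rdist_triangle minor_connect b a t'.
have := rdist_triangle conn v (val a) u; rewrite (rdistC G (val a) v) (rdistC G q (val b)).
have := rdist_ge0 G v u; have := gwt_ge0 qu; have := rdist_ge0 G q (val t'); lra.
Qed.

(** Leaving the cluster at its topmost vertex [v] restores the inequality that [last_exit] must
    carry for the next exit. *)
Lemma top_of_cluster_le t' s v v' a : v \in C a -> v' \notin C a -> gadj G v v' ->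
  side G v' v r -> last_exit t' s v a ->
  rdist M a t' + d (val a) v <= 5 * d v (val t').
Proof.
move=> va v'a vv' rv' [->|[u [q [b [[ua qb ab qu ru] _ e1 e2 F]]]]].
  by rewrite rdist0 rdistC; have := rdist_ge0 G v (val t'); lra.
have v'v : gadj G v' v by rewrite gadj_sym.
have ra := rdist_cut treeG v'v rv' (cluster_side va v'a).
have rv := rdist_cut treeG v'v rv' (connect0 _ v : side G v v' v).
rewrite rdist0 in rv.
have uq : gadj G u q by rewrite gadj_sym.
(* Let [w] be the weight of the edge [u q] and [L = d v u + w]. The terminal [s'] nearest to [q] is
   processed after [a], whence [d v a <= L + D q]; moreover [3 D q <= d q a <= L + d v a]. Together
   [d v a <= 2 L], so the left side is at most [2 d v a + d v u <= 5 d v u + 4 w]. If [u] is the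
   terminal [a], the left side is just [d v u]. *)
suff : d (val a) u + d (val a) v <= 5 * d v u + 4 * gwt G q u.
  have := minor_edge_le ua qb ab qu; have := rdist_triangle minor_connect b a t'.
  rewrite (rdistC G q (val b)); lra.
rewrite !(rdistC G (val a)).
have := rdist_ge0 G v u; have := gwt_ge0 qu.
case: (exit_edge qu ru qb ua ab) => [<-|[lt_ab le_q]]; first by rewrite rdist0; lra.
have [s' [b' [Dq qb' le_bs]]] := cover t' q.
rewrite (cluster_uniq qb' qb) in le_bs.
have := rdist_idx (leq_trans (ltnW lt_ab) le_bs).
have := rdist_triangle conn q r (val s'); have := rdist_triangle conn u r q.
have := rdist_edge conn uq; rewrite gwt_sym.
have := rdist_step conn (val a) qu.
have := rdist_triangle conn v u (val a); rewrite (rdistC G u v); lra.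
Qed.

(** Climbing from [t'], the last exit is inherited as long as the path stays in one cluster and is
    renewed whenever it enters another. *)
Lemma chain t' p1 p2 a :
  path (gadj G) (val t') (p1 ++ p2) -> uniq (val t' :: p1 ++ p2) ->
  last (val t') (p1 ++ p2) = r -> last (val t') p1 \in C a ->
  last_exit t' (val t' :: p1) (last (val t') p1) a.
Proof.
elim/last_ind: p1 p2 a => [|p1 v' IH] p2 a.
  by move=> _ _ _ /= ta; left; apply: cluster_uniq ta (terminal_in_cluster t').
rewrite last_rcons cat_rcons => tp up er v'a.
set v := last (val t') p1; have [c vc] := cover_cluster t' v.
have IHv := IH _ _ tp up er vc; rewrite -/v in IHv.
move: tp; rewrite cat_path /= -/v => /and3P[tp1 vv' v'p2].
have v'v : gadj G v' v by rewrite gadj_sym.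
move: up; rewrite -cat_cons cat_uniq => /and3P[_ /norP[v'p1 /hasPn p2p1] _].
have sv x : x \in val t' :: p1 -> side G v v' x.
  move=> xp1; have h y : y \in val t' :: p1 -> connect (del_edge G v v') (val t') y.
    by apply: path_connect; apply: del_edge_path; rewrite ?v'p1.
  by rewrite /side; apply: connect_trans (h x xp1); rewrite del_edge_sym h ?mem_last.
have rv' : side G v' v r.
  have av : (v \notin v' :: p2) || (v' \notin v' :: p2).
    apply/orP; left; apply/negP; rewrite inE => /orP[/eqP e|/p2p1].
      by move: v'v; rewrite e gadj_irr.
    by rewrite mem_last.
  have rin : r \in v' :: p2 by rewrite -er last_cat /= mem_last.
  exact: side_path v'p2 av (connect0 _ _) rin.
have v'v' : side G v' v v' by apply: connect0.
have dv' x : x \in val t' :: p1 -> d v' x = gwt G v v' + d v x.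
  by move=> /sv xs; rewrite (rdist_cut treeG v'v v'v' xs) rdist0 add0r gwt_sym.
have drv : d r v = d r v' + gwt G v v'.
  by rewrite (rdist_cut treeG v'v rv' (sv _ (mem_last _ _))) rdist0 addr0 gwt_sym.
have [ca|ca] := eqVneq c a.
  case: IHv => [<-|[u [q [b [H us e1 e2 F]]]]]; first by left.
  right; exists u, q, b; rewrite -ca; split=> //.
  - by rewrite -rcons_cons mem_rcons inE us orbT.
  - by rewrite !dv' ?mem_head // e1; lra.
  - by rewrite dv' //; lra.
have v'c : v' \notin C c.
  by apply: contra ca => v'c; apply/eqP; apply: cluster_uniq v'c v'a.
right; exists v', v, c; split=> //.
- by split=> //; rewrite eq_sym.
- by rewrite -rcons_cons mem_rcons inE eqxx.
- by rewrite rdist0 dv' ?mem_head // add0r.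
- by rewrite rdist0 addr0.
- exact: top_of_cluster_le vc v'c vv' rv' IHv.
Qed.

Lemma distortion t t' : rdist M t t' <= 8 * d (val t) (val t').
Proof.
have [p [tp up er]] := exists_upath treeG (val t) r.
have [p' [tp' up' er']] := exists_upath treeG (val t') r.
have [v [vp vp' e]] := exists_apex treeG tp up er tp' up' er'.
have [a va] := cover_cluster t v.
have F (x : S) q : path (gadj G) (val x) q -> uniq (val x :: q) -> last (val x) q = r ->
    v \in val x :: q -> rdist M a x <= d v (val a) + 5 * d v (val x).
  move=> xq uq eq vq; case/splitPl: vq xq uq eq => p1 p2 ev xq uq eq.
  have h : last (val x) p1 \in C a by rewrite ev.
  by have := last_exit_le h (chain xq uq eq h); rewrite ev.
have := F _ _ tp up er vp; have := F _ _ tp' up' er' vp'.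
have := rdist_triangle minor_connect a t t'; rewrite (rdistC M t a) (rdistC G (val t) v) in e *.
have := cluster_le va; have := rtdist_le conn v (valP t); have := rtdist_le conn v (valP t').
lra.
Qed.

End Rooted.

Lemma minor_dist_ge t t' : (dist G (val t) (val t') <= dist (minor G C) t t')%E.
Proof.
rewrite (distE conn) (distE minor_connect) lee_fin.
apply: (le_rdist minor_connect) => p + <-.
elim: p t => [|x p IH] t /=; first by rewrite rdist0.
move=> /andP[_ /IH]; have := rdist_triangle conn (val x) (val t) (val (last x p)).
by rewrite /minor_wt /rdist; lra.
Qed.

End Clusters.

Lemma grv_distortion (R : realType) (V : finType) (T : wgraph R V) (K : {set V}) (r : V)
    (pi : seq {t : V | t \in K}) (C : {t : V | t \in K} -> {set V}) :
  is_tree T -> ordered_from T r pi -> grv T (fun=> 3) pi C ->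
  forall t t' : {t : V | t \in K}, t != t' ->
    (dist T (val t) (val t') <= dist (minor T C) t t')%E /\
    (dist (minor T C) t t' <= 8%:E * dist T (val t) (val t'))%E.
Proof.
move=> treeT [ord_pi sorted_pi] grvC t t' _; split; first exact: minor_dist_ge grvC _ _.
rewrite (distE (minor_connect treeT ord_pi grvC)) (distE (proj1 treeT)) -EFinM lee_fin.
exact: distortion sorted_pi _ _.
Qed.

(** * Cost of breadth-first search *)

Section Runs.
Variable R : realType.
Implicit Types (s : store R) (c d : com) (n k : nat).

(** Total correctness with a time bound, in weakest-precondition form: [Q] may itself be a [runs]
    statement, so programs are executed symbolically from left to right. *)
Definition runs c s n (Q : store R -> Prop) : Prop :=
  exists s' m, [/\ exec c s s' m, (m <= n)%N & Q s'].

Lemma runs_weaken c s n n' (Q Q' : store R -> Prop) :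
  runs c s n Q -> (n <= n')%N -> (forall s', Q s' -> Q' s') -> runs c s n' Q'.
Proof.
move=> [s' [m [e le_m q]]] nn' QQ'; exists s', m; split=> //; last exact: QQ'.
exact: leq_trans le_m nn'.
Qed.

Lemma runs_skip s (Q : store R -> Prop) : Q s -> runs Skip s 1 Q.
Proof. by move=> q; exists s, 1%N; split=> //; constructor. Qed.

Lemma runs_nset a i e s (Q : store R -> Prop) :
  Q (Store (upd (nmem s) a (neval s i) (neval s e)) (rmem s)) -> runs (NSet a i e) s 1 Q.
Proof. by move=> q; eexists _, 1%N; split; [constructor| |exact: q]. Qed.

Lemma runs_rset a i x s (Q : store R -> Prop) :
  Q (Store (nmem s) (upd (rmem s) a (neval s i) (reval s x))) -> runs (RSet a i x) s 1 Q.
Proof. by move=> q; eexists _, 1%N; split; [constructor| |exact: q]. Qed.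

Lemma runs_seq c d s n1 n2 (Q : store R -> Prop) :
  runs c s n1 (fun s' => runs d s' n2 Q) -> runs (Seq c d) s (n1 + n2) Q.
Proof.
move=> [s1 [m1 [e1 le1 [s2 [m2 [e2 le2 q]]]]]]; exists s2, (m1 + m2)%N.
by split=> //; [apply: exec_seq e1 e2|apply: leq_add].
Qed.

Lemma runs_nset_seq a i e d s n (Q : store R -> Prop) :
  runs d (Store (upd (nmem s) a (neval s i) (neval s e)) (rmem s)) n Q ->
  runs (Seq (NSet a i e) d) s n.+1 Q.
Proof. by move=> H; apply: (@runs_seq _ _ _ 1); apply: runs_nset. Qed.

Lemma runs_rset_seq a i x d s n (Q : store R -> Prop) :
  runs d (Store (nmem s) (upd (rmem s) a (neval s i) (reval s x))) n Q ->
  runs (Seq (RSet a i x) d) s n.+1 Q.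
Proof. by move=> H; apply: (@runs_seq _ _ _ 1); apply: runs_rset. Qed.

Lemma runs_if b c d s n (Q : store R -> Prop) :
  runs (if beval s b then c else d) s n Q -> runs (If b c d) s n.+1 Q.
Proof. by move=> [s1 [m [e le_m q]]]; exists s1, m.+1; split=> //; constructor. Qed.

(** The index [k] is a potential: an iteration of cost [n] lowers it by more than [n], which also
    pays for the test. The extra step is the final, failing test. This is what allows amortised
    bounds for nested loops. *)
Lemma runs_while (I : nat -> store R -> Prop) b c :
  (forall k s, I k s -> beval s b ->
    exists n, runs c s n (fun s' => exists2 k', I k' s' & (n + k' < k)%N)) ->
  forall k s, I k s ->
    runs (While b c) s k.+1 (fun s' => (exists k', I k' s') /\ ~~ beval s' b).
Proof.
move=> step k; have [j] := ubnP k; elim: j k => // j IH k; rewrite ltnS => kj s Is.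
have [bs|nbs] := boolP (beval s b); last first.
  exists s, 1%N; split=> //; [exact: exec_while_end|by split=> //; exists k].
have [n [s1 [m1 [e1 le1 [k1 I1 lt1]]]]] := step k s Is bs.
have [|s2 [m2 [e2 le2 q]]] := IH k1 _ s1 I1; first by lia.
exists s2, (m1 + m2).+1; split=> //; [exact: exec_while_step bs e1 e2|lia].
Qed.

Definition framed (la lr : seq nat) s s' : Prop :=
  (forall a i, a \notin la -> nmem s' a i = nmem s a i) /\
  (forall a i, a \notin lr -> rmem s' a i = rmem s a i).

Lemma upd_same (T : Type) (f : nat -> nat -> T) a i x : upd f a i x a i = x.
Proof. by rewrite /upd !eqxx. Qed.

Lemma upd_array (T : Type) (f : nat -> nat -> T) a i x a' i' : a' != a ->
  upd f a i x a' i' = f a' i'.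
Proof. by rewrite /upd => /negbTE->. Qed.

Lemma framed_trans la lr s1 s2 s3 :
  framed la lr s1 s2 -> framed la lr s2 s3 -> framed la lr s1 s3.
Proof.
by move=> [n1 r1] [n2 r2]; split=> a i h; [rewrite n2 ?n1|rewrite r2 ?r1].
Qed.

Lemma framed_sub la lr la' lr' s1 s2 : {subset la <= la'} -> {subset lr <= lr'} ->
  framed la lr s1 s2 -> framed la' lr' s1 s2.
Proof.
move=> sa sr [n1 r1]; split=> a i h; [apply: n1|apply: r1].
  by apply: contra h => /sa.
by apply: contra h => /sr.
Qed.

Lemma framed_nset la lr s0 f g a i x : a \in la -> framed la lr s0 (Store f g) ->
  framed la lr s0 (Store (upd f a i x) g).
Proof.
move=> aa [n1 r1]; split=> a' j h //=; last exact: r1.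
rewrite /upd; case: eqP => [e|_] /=; first by rewrite e aa in h.
exact: n1.
Qed.

Lemma framed_rset la lr s0 f g a i x : a \in lr -> framed la lr s0 (Store f g) ->
  framed la lr s0 (Store f (upd g a i x)).
Proof.
move=> aa [n1 r1]; split=> a' j h //=; first exact: n1.
rewrite /upd; case: eqP => [e|_] /=; first by rewrite e aa in h.
exact: r1.
Qed.

End Runs.

Notation "a '%v'" := (NGet a (NLit 0)) (at level 2, format "a %v").
Notation setv a e := (NSet a (NLit 0) e).
Definition BLt (e f : nexp) : bexp := BNot (BLe f e).
Notation "c ;; d" := (Seq c d) (at level 60, right associativity).

Notation aHead := 8%N (only parsing).
Notation aTail := 9%N (only parsing).
Notation aRoot := 10%N (only parsing).
Notation aL := 11%N (only parsing).
Notation aX := 12%N (only parsing).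
Notation aI := 13%N (only parsing).
Notation aQ := 14%N (only parsing).
Notation aPar := 15%N (only parsing).
Notation aMark := 16%N (only parsing).
Notation rD := 2%N (only parsing).
Notation rDist := 3%N (only parsing).

(* The mark of a vertex is [0] if it is unclustered and the successor of the code
   of its terminal otherwise. *)
Definition visit (acc : bexp) : com :=
  If (BAnd (BLe (NGet aMark (NGet aNbr aL%v)) (NLit 0)) acc)
    (NSet aMark (NGet aNbr aL%v) (NGet aMark aX%v) ;;
     NSet aPar (NGet aNbr aL%v) aX%v ;;
     RSet rDist (NGet aNbr aL%v) (RAdd (RGet rDist aX%v) (RGet rLen aL%v)) ;;
     NSet aQ aTail%v (NGet aNbr aL%v) ;;
     setv aTail (NSucc aTail%v))
    Skip ;;
  setv aL (NSucc aL%v).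

(** Queue cells are never overwritten during a search, so [aQ] ends up listing the visited vertices
    with parents before children, which [save_order] exploits. *)
Definition explore (acc : bexp) : com :=
  NSet aQ (NLit 0) aRoot%v ;;
  setv aHead (NLit 0) ;;
  setv aTail (NLit 1) ;;
  NSet aMark aRoot%v (NSucc aRoot%v) ;;
  RSet rDist aRoot%v RZero ;;
  While (BLt aHead%v aTail%v)
    (setv aX (NGet aQ aHead%v) ;;
     setv aHead (NSucc aHead%v) ;;
     setv aL (NGet aOff aX%v) ;;
     While (BLt aL%v (NGet aOff (NSucc aX%v))) (visit acc)).

(** * Correctness of the search in a tree *)

Section Explore.
Variables (R : realType) (V : finType) (G : wgraph R V).
Hypothesis treeG : is_tree G.
Local Notation d := (rdist G).

Lemma code_inj : injective (@code V).
Proof. by move=> u v h; apply: (@enum_rank_inj V); apply: ord_inj. Qed.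

Lemma code_eq (u v : V) : (code u == code v) = (u == v).
Proof. exact: inj_eq code_inj u v. Qed.

Definition degree (v : V) : nat := #|gadj G v|.

(** Names the order in which the memory stores each neighbourhood, so that positions become indices
    in a list. *)
Definition adj_lists (nb : V -> seq V) (s : store R) : Prop :=
  forall v, [/\ perm_eq (nb v) (enum (gadj G v)),
    nmem s aOff (code v).+1 = (nmem s aOff (code v) + size (nb v))%N
    & forall k, (k < size (nb v))%N ->
      nmem s aNbr (nmem s aOff (code v) + k) = code (nth v (nb v) k) /\
      rmem s rLen (nmem s aOff (code v) + k) = gwt G v (nth v (nb v) k)].

Lemma adj_lists_framed nb la lr s s' : aOff \notin la -> aNbr \notin la ->
  rLen \notin lr -> framed la lr s s' -> adj_lists nb s -> adj_lists nb s'.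
Proof.
move=> o n l [Hn Hr] H v; have [H1 H2 H3] := H v; rewrite !Hn //; split=> // k.
by move=> /H3; rewrite Hn // Hr.
Qed.

Definition exploreN := [:: aHead; aTail; aL; aX; aQ; aPar; aMark].
Definition exploreR := [:: rDist].

Variables (nb : V -> seq V) (s0 : store R) (t : V) (ok : pred V) (acc : bexp).
Hypothesis nbP : adj_lists nb s0.

(** The root is removed explicitly: it is unmarked before the first search, but already marked when
    its cluster is grown. *)
Let A : {set V} := [set v | nmem s0 aMark (code v) == 0%N] :\ t.

Definition explored : {set V} :=
  [set v | connect (fun x y => [&& gadj G x y, y \in A & ok y]) t v].

(** The test is specified only where the candidate distance computed by the machine is exact, which
    [rdist_new] guarantees for new vertices. *)
Hypothesis accP : forall s y, framed exploreN exploreR s0 s ->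
  nmem s aNbr (nmem s aL 0) = code y ->
  rmem s rDist (nmem s aX 0) + rmem s rLen (nmem s aL 0) = d t y ->
  beval s acc = ok y.

(** The ghost list [q] holds all vertices ever enqueued, and [h] counts those whose lists have been
    scanned. By [qi_connect] the visited vertices stay connected when any edge to an unvisited one
    is deleted; in a tree such an edge then separates [t] from its new endpoint. *)
Record queue_inv (q : seq V) (h : nat) (s : store R) : Prop := QueueInv {
  qi_framed : framed exploreN exploreR s0 s;
  qi_uniq : uniq q;
  qi_size : (0 < size q)%N;
  qi_head : nth t q 0 = t;
  qi_queue : forall k, (k < size q)%N -> nmem s aQ k = code (nth t q k);
  qi_tail : nmem s aTail 0 = size q;
  qi_mark : forall v, nmem s aMark (code v) =
    if v \in q then (code t).+1 else nmem s0 aMark (code v);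
  qi_dist : forall v, v \in q -> rmem s rDist (code v) = d t v;
  qi_dist_out : forall v, v \notin q -> rmem s rDist (code v) = rmem s0 rDist (code v);
  qi_par : forall k, (0 < k < size q)%N -> exists j, [/\ (j < k)%N,
    gadj G (nth t q k) (nth t q j), nmem s aPar (code (nth t q k)) = code (nth t q j)
    & d t (nth t q j) + gwt G (nth t q j) (nth t q k) = d t (nth t q k)];
  qi_reached : {subset q <= explored};
  qi_connect : forall v x y, v \in q -> y \notin q -> connect (del_edge G x y) t v;
  qi_closed : forall k y, (k < h)%N -> gadj G (nth t q k) y -> y \in A -> ok y ->
    y \in q }.

Lemma queue_inv_tail q h s : queue_inv q h s -> t \in q.
Proof. by move=> H; rewrite -(qi_head H) mem_nth // (qi_size H). Qed.

Lemma unmarked q h s y : queue_inv q h s ->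
  (nmem s aMark (code y) <= 0)%N = (y \in A) && (y \notin q).
Proof.
move=> H; rewrite (qi_mark H) !inE; case: (boolP (y \in q)) => yq; first by rewrite andbF.
rewrite andbT leqn0; case: (eqVneq y t) => // e.
by rewrite e (queue_inv_tail H) in yq.
Qed.

Lemma queue_inv_setv q h s a x : a \in [:: aHead; aL; aX] -> queue_inv q h s ->
  queue_inv q h (Store (upd (nmem s) a 0 x) (rmem s)).
Proof.
move=> av H.
have E a' i : a' \notin [:: aHead; aL; aX] -> upd (nmem s) a 0 x a' i = nmem s a' i.
  by rewrite /upd; case: eqP => //= ->; rewrite av.
split=> //=; rewrite ?E //.
- apply: framed_nset; last exact: qi_framed H.
  move: av; rewrite !inE.
  by case/or3P => /eqP->.
- exact: qi_uniq H.
- exact: qi_size H.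
- exact: qi_head H.
- by move=> k kq; rewrite E // (qi_queue H).
- exact: qi_tail H.
- by move=> v; rewrite E // (qi_mark H).
- exact: qi_dist H.
- exact: qi_dist_out H.
- by move=> k /(qi_par H)[j [? ? ? ?]]; exists j; rewrite E.
- exact: qi_reached H.
- exact: qi_connect H.
- exact: qi_closed H.
Qed.

Definition scanning (p : seq V) (x : V) (j : nat) (s : store R) : Prop := exists q,
  [/\ queue_inv q (size p) s, exists q2, q = p ++ x :: q2,
      [/\ nmem s aHead 0 = (size p).+1, nmem s aX 0 = code x
        & nmem s aL 0 = (nmem s0 aOff (code x) + j)%N]
    & forall y, y \in take j (nb x) -> y \in A -> ok y -> y \in q].

Lemma rdist_new q h s x y : queue_inv q h s -> x \in q -> y \notin q -> gadj G x y ->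
  d t x + gwt G x y = d t y.
Proof.
move=> H xq yq xy; rewrite (rdist_cut treeG xy (x := t) (y := y)) ?rdist0 ?addr0 //.
  by rewrite /side del_edge_sym; apply: (qi_connect H).
exact: connect0.
Qed.

Lemma queue_inv_push q h s x y : queue_inv q h s -> (h <= size q)%N -> x \in q -> y \notin q ->
  y \in A -> gadj G x y -> ok y -> queue_inv (rcons q y) h
    (Store (upd (upd (upd (upd (nmem s) aMark (code y) (code t).+1)
                  aPar (code y) (code x)) aQ (size q) (code y)) aTail 0 (size q).+1)
           (upd (rmem s) rDist (code y) (d t y))).
Proof.
move=> H hq xq yq yA xy oky; split=> /=.
- by do 4! [apply: framed_nset => //]; apply: framed_rset; last exact: qi_framed H.
- by rewrite rcons_uniq yq (qi_uniq H).
- by rewrite size_rcons.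
- by rewrite nth_rcons (qi_size H) (qi_head H).
- move=> k; rewrite size_rcons ltnS leq_eqVlt nth_rcons /upd /= => /orP[/eqP->|kq].
    by rewrite ltnn eqxx.
  by rewrite kq (ltn_eqF kq) (qi_queue H).
- by rewrite size_rcons /upd.
- move=> v; rewrite /upd /= code_eq mem_rcons inE (qi_mark H).
  by case: eqP.
- move=> v; rewrite mem_rcons inE /upd /= code_eq; case: eqP => [->//|_ /= vq].
  exact: (qi_dist H vq).
- move=> v; rewrite mem_rcons inE negb_or /upd /= code_eq => /andP[/negbTE-> vq].
  exact: (qi_dist_out H vq).
- move=> k /andP[k0]; rewrite size_rcons ltnS leq_eqVlt => /orP[/eqP->|kq].
    exists (index x q); rewrite !nth_rcons ltnn eqxx index_mem xq nth_index //.
    by rewrite /upd /= eqxx gadj_sym (rdist_new H xq yq xy).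
  have [|j [jk adj e ew]] := qi_par H (k := k); first by rewrite k0.
  exists j; rewrite !nth_rcons kq (ltn_trans jk kq); split=> //.
  rewrite /upd /= code_eq; case: eqP => // ey; case/negP: yq.
  by rewrite -ey mem_nth.
- move=> v; rewrite mem_rcons inE => /orP[/eqP->|/(qi_reached H)//].
  have := qi_reached H xq; rewrite !inE => tx; apply: connect_trans tx (connect1 _).
  by move: yA; rewrite xy oky !inE => ->.
- move=> v a b; rewrite !mem_rcons !inE negb_or => /orP[/eqP->|vq] /andP[b1 b2]; last first.
    exact: (qi_connect H a vq b2).
  apply: connect_trans (qi_connect H a xq b2) (connect1 _).
  rewrite /del_edge xy (eq_sym y) (negbTE b1) andbF /= negb_and.
  by apply/orP; left; apply: contraNneq b2 => <-.
- move=> k z kh; rewrite mem_rcons inE nth_rcons.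
  by rewrite (leq_trans kh hq) => kz zA okz; rewrite (qi_closed H kh kz zA okz) orbT.
Qed.

Lemma nb_adj v x : x \in nb v = gadj G v x.
Proof. by have [/perm_mem-> _ _] := nbP v; rewrite mem_enum. Qed.

Lemma visit_step p x j s : (j < size (nb x))%N -> scanning p x j s ->
  runs (visit acc) s 7 (scanning p x j.+1).
Proof.
move=> jx [q [H [q2 eq] [eH eX eL] scan]].
have hq : (size p < size q)%N by rewrite eq size_cat -addSnnS leq_addr.
have [nAll n2 n3] : [/\ forall a i, a \notin exploreN -> nmem s a i = nmem s0 a i,
   nmem s aNbr (nmem s aL 0) = code (nth x (nb x) j) &
   rmem s rLen (nmem s aL 0) = gwt G x (nth x (nb x) j)].
  have [f1 f2] := qi_framed H; have [_ _ /(_ j jx)[e1 e2]] := nbP x.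
  by rewrite eL f1 // f2.
set y := nth x (nb x) j in n2 n3.
have xy : gadj G x y by rewrite -nb_adj mem_nth.
have xq : x \in q by rewrite eq mem_cat mem_head orbT.
have take_y z : z \in take j.+1 (nb x) -> z = y \/ z \in take j (nb x).
  by rewrite (take_nth x jx) mem_rcons inE => /orP[/eqP|]; [left|right].
rewrite /visit; apply: (@runs_seq _ _ _ _ 6 1); apply: runs_if.
rewrite /= n2 (unmarked y H); case: ifP => [/andP[/andP[yA yq] aok]|nacc].
  rewrite (accP (qi_framed H) n2) in aok; last first.
    by rewrite eX (qi_dist H xq) n3 (rdist_new H xq yq xy).
  do 4! first [apply: runs_nset_seq | apply: runs_rset_seq]; do 2! apply: runs_nset.
  rewrite /= !(upd_same, upd_array) //= n2 eX n3 eL (qi_tail H) (qi_mark H) xq.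
  rewrite (qi_dist H xq) (rdist_new H xq yq xy).
  have Hp := queue_inv_push H (ltnW hq) xq yq yA xy aok.
  exists (rcons q y); split.
  - exact: queue_inv_setv Hp.
  - by exists (rcons q2 y); rewrite eq rcons_cat rcons_cons.
  - by split=> //=; rewrite upd_same addnS.
  - move=> z /take_y[->|/scan zq] zA okz; rewrite mem_rcons inE ?eqxx //.
    by rewrite zq ?orbT.
apply: (@runs_weaken _ _ _ 1); [apply: runs_skip|by []|by move=> s' P; exact: P].
apply: runs_nset; exists q; split=> //=.
- exact: queue_inv_setv.
- by exists q2.
- by rewrite !(upd_same, upd_array) //= eL addnS.
- move=> z /take_y[->|/scan//] yA oky.
  move: nacc; rewrite yA /=; case: (boolP (y \in q)) => // yq.
  by rewrite (accP (qi_framed H) n2) ?oky // eX (qi_dist H xq) n3 (rdist_new H xq yq xy).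
Qed.

Lemma degreeE v : degree v = size (nb v).
Proof. by have [/perm_size-> _ _] := nbP v; rewrite /degree cardE. Qed.

Lemma scan_loop p x s : scanning p x 0 s ->
  runs (While (BLt aL%v (NGet aOff (NSucc aX%v))) (visit acc)) s (8 * degree x).+1
    (scanning p x (size (nb x))).
Proof.
move=> s0P.
pose I k s := exists2 j, (j <= size (nb x))%N /\ k = (8 * (size (nb x) - j))%N
  & scanning p x j s.
have testE j s' : scanning p x j s' ->
    beval s' (BLt aL%v (NGet aOff (NSucc aX%v))) = (j < size (nb x))%N.
  move=> [q [H _ [_ eX eL] _]]; rewrite /= eL eX (proj1 (qi_framed H)) //.
  by have [_ -> _] := nbP x; rewrite leq_add2l ltnNge.
have step k s1 : I k s1 -> beval s1 (BLt aL%v (NGet aOff (NSucc aX%v))) ->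
    exists n, runs (visit acc) s1 n (fun s2 => exists2 k', I k' s2 & (n + k' < k)%N).
  move=> [j [jn ->] sc]; rewrite (testE _ _ sc) => jx.
  exists 7; apply: runs_weaken (visit_step jx sc) (leqnn _) _ => s2 sc2.
  exists (8 * (size (nb x) - j.+1))%N; last by lia.
  by exists j.+1.
apply: runs_weaken (runs_while step _) (leqnn _) _.
  by exists 0; rewrite // degreeE subn0.
move=> s2 [[k [j [jn _] sc]]]; rewrite (testE _ _ sc) -leqNgt => nj.
by have <- : j = size (nb x) by apply/eqP; rewrite eqn_leq jn.
Qed.

(** A scanned neighbour costs 7 steps and a test; the additional 8 per vertex cover its removal from
    the queue and the overhead of the two loops. *)
Definition explore_cost : nat := (\sum_(v in explored) 8 * (degree v).+1)%N.

Lemma queue_inv_advance p x s : scanning p x (size (nb x)) s ->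
  exists q, [/\ queue_inv q (size p).+1 s, exists q2, q = p ++ x :: q2 & nmem s aHead 0 = (size p).+1].
Proof.
move=> [q [H [q2 eq] [eH _ _] scan]]; exists q; split=> //; last by exists q2.
have Hc := qi_closed H; case: H => *; split=> //.
move=> k y; rewrite ltnS leq_eqVlt => /orP[/eqP->|kp]; last exact: Hc.
rewrite {1}eq nth_cat ltnn subnn /= => xy; apply: scan.
by rewrite take_size nb_adj.
Qed.

Lemma queue_inv_explored q s : queue_inv q (size q) s -> explored =i q.
Proof.
move=> H v; apply/idP/idP; last exact: (qi_reached H).
rewrite inE => /connectP[p tp ->]; have := queue_inv_tail H.
elim: p (t) tp => //= y p IH z /andP[/and3P[zy yA oky] yp] zq; apply: IH yp _.
apply: (qi_closed H (k := index z q) (y := y)) => //; first by rewrite index_mem.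
by rewrite nth_index.
Qed.

Lemma explore_init : nmem s0 aRoot 0 = code t -> queue_inv [:: t] 0
  (Store (upd (upd (upd (upd (nmem s0) aQ 0 (code t)) aHead 0 0) aTail 0 1) aMark
    (code t) (code t).+1) (upd (rmem s0) rDist (code t) 0)).
Proof.
move=> er; split=> //=.
- by do 4! [apply: framed_nset => //]; apply: framed_rset.
- by case.
- by move=> v; rewrite /upd /= code_eq inE.
- by move=> v; rewrite inE => /eqP->; rewrite upd_same rdist0.
- by move=> v; rewrite inE /upd /= code_eq => /negbTE->.
- by case.
- by move=> v; rewrite !inE => /eqP->; rewrite connect0.
- by move=> v x y; rewrite !inE => /eqP-> _; apply: connect0.
Qed.

Lemma explore_spec : nmem s0 aRoot 0 = code t ->
  runs (explore acc) s0 explore_cost.+2.+4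
    (fun s => exists2 q, queue_inv q (size q) s & explored =i q).
Proof.
move=> er; rewrite /explore; do 4 apply: runs_nset_seq; apply: runs_rset_seq.
rewrite /= !(upd_same, upd_array) //= er.
(* The potential is the cost of the explored vertices still to be dequeued. *)
pose I k s := exists q h, [/\ queue_inv q h s, (h <= size q)%N, nmem s aHead 0 = h &
  k = (\sum_(v in explored | v \notin take h q) 8 * (degree v).+1)%N].
have testE q h s : queue_inv q h s -> nmem s aHead 0 = h ->
    beval s (BLt aHead%v aTail%v) = (h < size q)%N.
  by move=> H eh; rewrite /= eh (qi_tail H) ltnNge.
have h0 := explore_init er.
apply: runs_weaken (@runs_while _ I _ _ _ explore_cost _ _) (leqnn _) _.
- move=> k s [q [h [H hq eh ->]]]; rewrite (testE _ _ _ H eh) => hq'.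
  pose x := nth t q h; pose p := take h q.
  have sp : size p = h by rewrite size_take hq'.
  have eq : q = p ++ x :: drop h.+1 q by rewrite -drop_nth // cat_take_drop.
  have xq : x \in q by rewrite mem_nth.
  exists (3 + (8 * degree x).+1)%N.
  do 3 apply: runs_nset_seq; rewrite /= !(upd_same, upd_array) //= eh (qi_queue H) //.
  apply: runs_weaken (scan_loop (p := p) (x := x) _) (leqnn _) _.
    exists q; split=> //=.
    + rewrite sp; have H1 := @queue_inv_setv q h s aX (code x) isT H.
      have H2 := @queue_inv_setv q h _ aHead h.+1 isT H1.
      exact: (@queue_inv_setv q h _ aL (nmem s aOff (code x)) isT H2).
    + by exists (drop h.+1 q).
    + split; rewrite ?(upd_same, upd_array) ?sp //= addn0.
      by rewrite (proj1 (qi_framed H)).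
    + by rewrite take0.
  move=> s2 /queue_inv_advance[q' [H' [q2 eq'] eh']].
  eexists; first exists q', (size p).+1; first split; try reflexivity.
  + exact: H'.
  + by rewrite eq' size_cat /= addnS ltnS leq_addr.
  + exact: eh'.
  have xe : x \in explored := qi_reached H xq.
  have xp : x \notin p.
    by have := qi_uniq H; rewrite eq cat_uniq /= negb_or => /and3P[_ /andP[]].
  rewrite eq' -cat_rcons take_cat size_rcons ltnn subnn take0 cats0 -/p.
  rewrite [X in (_ < X)%N](bigD1 x) ?xe ?xp //=.
  rewrite [X in (_ < _ + X)%N](eq_bigl (fun v => (v \in explored) && (v \notin rcons p x))).
    by rewrite ltn_add2r; lia.
  by move=> v; rewrite mem_rcons inE negb_or -andbA [(v \notin p) && _]andbC.
- exists [:: t], 0; split=> //.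
  by rewrite /explore_cost take0; apply: eq_bigl => v; rewrite andbT.
move=> s [[k [q [h [H hq eh _]]]]]; rewrite (testE _ _ _ H eh) -leqNgt => qh.
have e : h = size q by apply/eqP; rewrite eqn_leq hq.
by rewrite e in H; exists q => //; apply: queue_inv_explored H.
Qed.

End Explore.

(** * Existence of a run of the algorithm *)

Section GrvExists.
Variables (R : realType) (V : finType) (G : wgraph R V) (K : {set V}).
Local Notation S := {t : V | t \in K}.
Variable mag : S -> R.

Lemma eq_grv_loop (A : {set V}) (pi : seq S) (C C' : S -> {set V}) :
  {in pi, C =1 C'} -> grv_loop G mag A pi C -> grv_loop G mag A pi C'.
Proof.
elim: pi A => //= t pi IH A e [g h]; rewrite -(e t (mem_head _ _)); split=> //.
by apply: IH h => x xpi; rewrite e // inE xpi orbT.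
Qed.

(** Each cluster is the component prescribed by [growP]; overriding the family at [t] does not
    disturb the later terminals because [pi] has no repetition. *)
Lemma grv_exists (pi : seq S) : uniq pi -> exists C, grv G mag pi C.
Proof.
rewrite /grv; have : [disjoint K & ~: K] by rewrite -setI_eq0 setICr.
elim: pi (~: K) => [|t pi IH] A disj; first by exists (fun=> finset.set0).
move=> /= /andP[tpi upi].
pose Ct := component G K (val t) (mag t) A.
have disj' : [disjoint K & A :\: Ct] by apply: disjointWr disj; apply: subsetDl.
have [C HC] := IH _ disj' upi.
exists (fun x => if x == t then Ct else C x); rewrite eqxx; split.
  by apply/growP => //; rewrite (disjointFr disj) ?(valP t).
apply: eq_grv_loop HC => x xpi; case: eqP => // e.
by rewrite -e xpi in tpi.
Qed.

End GrvExists.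

(** * Parent orders and the tree edges between clusters *)

Section RootedOrder.
Variables (R : realType) (V : finType) (G : wgraph R V).
Hypothesis treeG : is_tree G.
Local Notation d := (rdist G).
Let conn : forall u v, connect (gadj G) u v := proj1 treeG.

(** Abstracts what the first search leaves in memory: the root is the head of [q], and [par] is
    unconstrained there. *)
Definition rooted (q : seq V) (par : V -> V) : Prop :=
  [/\ uniq q, forall v, v \in q
    & forall v, (0 < index v q)%N ->
      (index (par v) q < index v q)%N /\ gadj G v (par v)].

Variables (q : seq V) (par : V -> V).
Hypothesis rq : rooted q par.

(** If an edge were not a parent edge, climbing through parents would join both its ends to the root
    without using it, contradicting [bridge]. *)
Lemma parent_edge u v : gadj G u v ->
  (0 < index u q)%N /\ par u = v \/ (0 < index v q)%N /\ par v = u.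
Proof.
move=> uv; have [uq qq parP] := rq; apply: contrapT => /not_orP[nu nv].
move/negP: (bridge treeG uv); apply.
have toroot x : forall y, index y q = 0%N -> connect (del_edge G u v) x y.
  have [n] := ubnP (index x q); elim: n x => // n IH x; rewrite ltnS => xn y y0.
  have [x0|x0] := posnP (index x q).
    suff -> : x = y by apply: connect0.
    by rewrite -(nth_index x (qq y)) y0 -x0 nth_index.
  have [lt_p xp] := parP x x0.
  apply: connect_trans (connect1 _) (IH (par x) _ y y0); last exact: leq_trans lt_p xn.
  rewrite /del_edge xp /= negb_or !negb_and; apply/andP; split.
    by case: eqP => //= xu; apply/eqP => pv; apply: nu; rewrite -xu.
  by case: eqP => //= xv; apply/eqP => pu; apply: nv; rewrite -xv.
have i0 : index (nth u q 0) q = 0%N.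
  by rewrite index_uniq // lt0n size_eq0; apply/eqP => q0; have := qq u; rewrite q0.
by apply: connect_trans (toroot u _ i0) _; rewrite del_edge_sym toroot.
Qed.

(** The neighbours of a vertex are among its parent and its children, and each vertex is counted as
    a child only once. *)
Lemma sum_degree : (\sum_v degree G v <= 2 * #|V|)%N.
Proof.
have le v : (degree G v <= 1 + \sum_(y | par y == v) 1)%N.
  rewrite sum1_card -(card1 (par v)); rewrite -cardUI.
  apply: leq_trans (leq_addr _ _); apply: subset_leq_card; apply/fintype.subsetP => y; rewrite unfold_in => vy.
  rewrite !inE [X in _ || X]unfold_in; case: (parent_edge vy) => [[_ e]|[_ e]].
    by rewrite e eqxx.
  by rewrite -e; apply/orP; right; apply/eqP.
apply: (@leq_trans (\sum_v (1 + \sum_(y | par y == v) 1))); first exact: leq_sum.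
rewrite big_split /= sum1_card mul2n -addnn leq_add2l.
by rewrite -[X in (_ <= X)%N]sum1_card [X in (_ <= X)%N](partition_big par predT) //=.
Qed.

(** The inequality adds up along walks. It certifies computed distances: if moreover [f] is at most
    0 on the terminals, then [f] is at most the terminal distance. *)
Lemma lipschitz_le_dist (f : V -> R) :
  (forall u v, gadj G u v -> f u <= f v + gwt G u v) -> forall x y, f x <= d x y + f y.
Proof.
move=> lip x y; rewrite -lerBlDr; apply: (le_rdist conn) => p + <-.
elim: p x => /= [|z p IH] x; first by rewrite subrr.
by move=> /andP[/lip + /IH]; lra.
Qed.

Lemma rooted_lipschitz (f : V -> R) :
  (forall v, (0 < index v q)%N -> f v <= f (par v) + gwt G v (par v)) ->
  (forall v, (0 < index v q)%N -> f (par v) <= f v + gwt G v (par v)) ->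
  forall u v, gadj G u v -> f u <= f v + gwt G u v.
Proof.
move=> dn up u v uv; case: (parent_edge uv) => [[u0 <-]|[v0 <-]]; first exact: dn.
by rewrite gwt_sym; apply: up.
Qed.

Variables (K : {set V}) (pi : seq {t : V | t \in K}) (C : {t : V | t \in K} -> {set V}).
Local Notation S := {t : V | t \in K}.
Hypothesis ord_pi : ordering pi.
Hypothesis grvC : grv G (fun=> 3) pi C.
Variable cl : V -> S.
Hypothesis clP : forall v, v \in C (cl v).

Lemma cl_eq v a : v \in C a -> cl v = a.
Proof. by move=> va; apply: (cluster_uniq treeG ord_pi grvC (clP v) va). Qed.

(** A vertex stands for the edge to its parent, so the root is dropped. *)
Definition crossing : seq V := [seq v <- behead q | cl v != cl (par v)].

Lemma mem_crossing v : (v \in crossing) = (0 < index v q)%N && (cl v != cl (par v)).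
Proof.
rewrite mem_filter andbC; congr (_ && _); have [uq qq _] := rq.
case: q uq (qq v) => //= x s /andP[xs _]; rewrite inE => vxs.
case: (eqVneq x v) vxs => [<- _|_]; first by rewrite (negbTE xs).
by move=> /= ->.
Qed.

(** Two distinct tree edges joining the same two clusters would form a cycle with paths inside the
    clusters. Each cluster misses an end of the first edge, so it stays connected without that edge,
    and [bridge] is contradicted. *)
Lemma crossing_inj : {in crossing &, injective (fun v => [set cl v; cl (par v)])}.
Proof.
move=> v v'; rewrite !mem_crossing => /andP[v0 cv] /andP[v'0 cv'] e.
have [_ _ parP] := rq; have [lt vp] := parP v v0; have [lt' vp'] := parP v' v'0.
apply/eqP/negPn/negP => ne.
(* The second edge is not the first one reversed, since two vertices cannot be each other's
   parent. *)
have other : del_edge G v (par v) v' (par v').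
  rewrite /del_edge vp' (eq_sym v') (negbTE ne) /=; apply/negP => /andP[/eqP e1 /eqP e2].
  by move: lt lt'; rewrite e2 -e1 => h /(ltn_trans h); rewrite ltnn.
have inside x y : cl x = cl y -> connect (del_edge G v (par v)) x y.
  move=> cxy; have [u [uvp uC]] : exists u, (u == v) || (u == par v) /\ u \notin C (cl x).
    have [vx|vx] := eqVneq (cl v) (cl x).
      exists (par v); rewrite eqxx orbT; split=> //.
      by apply: contra cv => /cl_eq->; rewrite vx.
    exists v; rewrite eqxx; split=> //.
    by apply: contra vx => /cl_eq->.
  have h z : z \in C (cl x) -> connect (del_edge G v (par v)) (val (cl x)) z.
    case/orP: uvp uC => /eqP-> uC zC.
      rewrite (eq_connect (del_edgeC G v (par v))).
      exact: (cluster_connect ord_pi grvC _ uC zC).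
    exact: (cluster_connect ord_pi grvC _ uC zC).
  apply: connect_trans (h y _); first by rewrite del_edge_sym h.
  by rewrite cxy.
move/negP: (bridge treeG vp); apply; rewrite /side.
have : cl v' \in [set cl v; cl (par v)] by rewrite e !inE eqxx.
have : cl (par v') \in [set cl v; cl (par v)] by rewrite e !inE eqxx orbT.
rewrite !inE => /orP[/eqP h1|/eqP h1] /orP[/eqP h2|/eqP h2].
- by rewrite h1 h2 eqxx in cv'.
- apply: connect_trans (inside _ _ (esym h1)) _.
  rewrite del_edge_sym; apply: connect_trans (inside _ _ (esym h2)) (connect1 other).
- apply: connect_trans (inside _ _ (esym h2)) _.
  exact: connect_trans (connect1 other) (inside _ _ h1).
- by rewrite h1 h2 eqxx in cv'.
Qed.

Lemma crossing_edges : perm_eq [seq [set p.1; p.2] | p <- [seq (cl v, cl (par v)) | v <- crossing]]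
  (enum (edges (minor G C))).
Proof.
rewrite -map_comp; apply: uniq_perm; last move=> X.
- rewrite map_inj_in_uniq; first by rewrite filter_uniq // -drop1 drop_uniq //; case: rq.
  exact: crossing_inj.
- exact: enum_uniq.
rewrite mem_enum; apply/mapP/imsetP => [[v + ->]|[[a b] /= ab ->]].
  rewrite mem_crossing => /andP[v0 cv]; exists (cl v, cl (par v)) => //=.
  rewrite inE /= /minor_adj cv; apply/exists_inP; exists v => //.
  apply/exists_inP; exists (par v) => //.
  by have [_ _ /(_ v v0)[]] := rq.
move: ab; rewrite inE /= => /andP[nab /exists_inP[u ua /exists_inP[v vb uv]]].
rewrite -(cl_eq ua) -(cl_eq vb) in nab *.
case: (parent_edge uv) => [[u0 e]|[v0 e]].
  by exists u; rewrite ?mem_crossing ?u0 ?e.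
exists v; first by rewrite mem_crossing v0 e eq_sym.
by rewrite e finset.setUC.
Qed.

(** The edge from [v] to its parent separates the two cluster centres, so their distance splits
    there into quantities that the machine has already stored. *)
Lemma crossing_wt v : v \in crossing ->
  gwt (minor G C) (cl v) (cl (par v)) =
  d (val (cl v)) v + gwt G v (par v) + d (val (cl (par v))) (par v).
Proof.
rewrite mem_crossing => /andP[v0 cv]; have [_ _ /(_ v v0)[_ vp]] := rq.
have n1 : par v \notin C (cl v) by apply: contra cv => /cl_eq->.
have n2 : v \notin C (cl (par v)) by apply: contra cv => /cl_eq->.
have s1 := cluster_side ord_pi grvC (clP v) n1.
have s2 := cluster_side ord_pi grvC (clP (par v)) n2.
rewrite /= /minor_wt -/(d _ _) (rdist_cut treeG vp s1 s2).
by rewrite (rdistC G (par v)).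
Qed.

End RootedOrder.

(** * The linear-time program *)

Notation aOrder := 17%N (only parsing).
Notation aParent := 18%N (only parsing).
Notation rWt := 4%N (only parsing).

Definition incr : com := setv aI (NSucc aI%v).

Definition clear_marks : com :=
  setv aI (NLit 0) ;;
  While (BLt aI%v aN%v) (NSet aMark aI%v (NLit 0) ;; incr).

(* The sum stored in [rD] is only an upper bound of the distance to the terminals:
   it spares the machine a representation of [+oo]. *)
Definition save_order : com :=
  setv aI (NLit 0) ;;
  While (BLt aI%v aN%v)
    (RSet rD aI%v (RAdd (RGet rDist aI%v) (RGet rDist (NGet aTerm (NLit 0)))) ;;
     RSet rWt aI%v (RSub (RGet rDist aI%v) (RGet rDist (NGet aPar aI%v))) ;;
     NSet aOrder aI%v (NGet aQ aI%v) ;;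
     NSet aParent aI%v (NGet aPar aI%v) ;;
     NSet aMark aI%v (NLit 0) ;; incr).

Definition mark_terminals : com :=
  setv aI (NLit 0) ;;
  While (BLt aI%v aK%v)
    (RSet rD (NGet aTerm aI%v) RZero ;;
     NSet aMark (NGet aTerm aI%v) (NSucc (NGet aTerm aI%v)) ;; incr).

Definition cur : nexp := NGet aOrder aI%v.
Definition cur_parent : nexp := NGet aParent cur.

(** In both passes the relaxed edge is the one from [cur] to its parent, hence the fixed weight
    [RGet rWt cur]. *)
Definition relax (x y : nexp) : com :=
  If (BLeR (RAdd (RGet rD x) (RGet rWt cur)) (RGet rD y))
    (RSet rD y (RAdd (RGet rD x) (RGet rWt cur))) Skip.

(** The order is traversed backwards, so that a vertex has heard from all its children before it
    informs its parent. *)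
Definition relax_up : com :=
  setv aI aN%v ;;
  While (BLt (NLit 1) aI%v) (setv aI (NPred aI%v) ;; relax cur cur_parent).

Definition relax_down : com :=
  setv aI (NLit 1) ;;
  While (BLt aI%v aN%v) (relax cur_parent cur ;; incr).

(** The machine has no multiplication, so the factor 3 becomes a repeated sum. *)
Definition accept3 : bexp :=
  BLeR (RAdd (RGet rDist aX%v) (RGet rLen aL%v))
    (RAdd (RAdd (RGet rD (NGet aNbr aL%v)) (RGet rD (NGet aNbr aL%v)))
       (RGet rD (NGet aNbr aL%v))).

Definition grow_clusters : com :=
  setv aI (NLit 0) ;;
  While (BLt aI%v aK%v)
    (setv aRoot (NGet aTerm aI%v) ;; explore accept3 ;; incr).

(** Marks are successors of terminal codes, whence the predecessors; equality of marks is tested by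
    two comparisons. *)
Definition emit : com :=
  If (BAnd (BLe (NGet aMark cur) (NGet aMark cur_parent))
           (BLe (NGet aMark cur_parent) (NGet aMark cur))) Skip
    (NSet aOutSrc aOutN%v (NPred (NGet aMark cur)) ;;
     NSet aOutDst aOutN%v (NPred (NGet aMark cur_parent)) ;;
     RSet rOutLen aOutN%v
       (RAdd (RAdd (RGet rDist cur) (RGet rWt cur)) (RGet rDist cur_parent)) ;;
     setv aOutN (NSucc aOutN%v)).

Definition output_minor : com :=
  setv aOutN (NLit 0) ;;
  setv aI (NLit 1) ;;
  While (BLt aI%v aN%v) (emit ;; incr).

(** Without terminals the cell [aTerm 0] read by [save_order] has no meaning, so this case is
    answered at once with no edges. *)
Definition program : com :=
  If (BLe aK%v (NLit 0)) (setv aOutN (NLit 0))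
    (clear_marks ;; setv aRoot (NLit 0) ;; explore (BLe (NLit 0) (NLit 0)) ;;
     save_order ;; mark_terminals ;; relax_up ;; relax_down ;; grow_clusters ;;
     output_minor).

Lemma runs_for (R : realType) (P : nat -> store R -> Prop) (f : nat -> nat) lo hi b body :
  (lo <= hi)%N ->
  (forall i s, (i <= hi)%N -> P i s -> nmem s aI 0 = i -> beval s b = (i < hi)%N) ->
  (forall i s, (lo <= i < hi)%N -> P i s -> nmem s aI 0 = i ->
    runs body s (f i) (fun s' => P i.+1 s' /\ nmem s' aI 0 = i.+1)) ->
  forall s, P lo s -> nmem s aI 0 = lo ->
    runs (While b body) s (\sum_(lo <= i < hi) (f i).+1).+1 (P hi).
Proof.
move=> lohi test step s Ps es.
pose I k s := exists i, [/\ (lo <= i <= hi)%N, P i s, nmem s aI 0 = i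
  & k = (\sum_(i <= j < hi) (f j).+1)%N].
apply: runs_weaken (@runs_while _ I _ _ _ _ _ _) (leqnn _) _.
- move=> k s1 [i [/andP[li ih] Pi ei ->]]; rewrite (test _ _ ih Pi ei) => lt_ih.
  exists (f i); apply: runs_weaken (step _ _ _ Pi ei) (leqnn _) _; first by rewrite li.
  move=> s2 [P2 e2]; eexists; first exists i.+1; first split; try reflexivity.
  + by rewrite (leq_trans li) //= lt_ih.
  + exact: P2.
  + exact: e2.
  by rewrite [X in (_ < X)%N]big_ltn // addSn.
- by exists lo; rewrite leqnn lohi.
move=> s1 [[k [i [/andP[_ ih] Pi ei _]]]]; rewrite (test _ _ ih Pi ei) -leqNgt => hi_i.
by have <- : i = hi by apply/eqP; rewrite eqn_leq ih.
Qed.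

Lemma runs_for_const (R : realType) (P : nat -> store R -> Prop) c lo hi b body :
  (lo <= hi)%N ->
  (forall i s, (i <= hi)%N -> P i s -> nmem s aI 0 = i -> beval s b = (i < hi)%N) ->
  (forall i s, (lo <= i < hi)%N -> P i s -> nmem s aI 0 = i ->
    runs body s c (fun s' => P i.+1 s' /\ nmem s' aI 0 = i.+1)) ->
  forall s, P lo s -> nmem s aI 0 = lo ->
    runs (While b body) s (hi * c.+1).+1 (P hi).
Proof.
move=> lohi test step s Ps es.
apply: runs_weaken (runs_for (f := fun=> c) lohi test step Ps es) _ _ => //.
by rewrite sum_nat_const_nat ltnS leq_mul2r leq_subr orbT.
Qed.

(** * Correctness and running time of the program *)

Section Program.
Variables (R : realType) (V : finType) (G : wgraph R V) (K : {set V}).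
Hypothesis treeG : is_tree G.
Local Notation d := (rdist G).
Local Notation D := (rtdist G K).
Local Notation S := {t : V | t \in K}.
Local Notation n := #|V|.
Let conn : forall u v, connect (gadj G) u v := proj1 treeG.
Variables (pi : seq S) (s0 : store R) (nb : V -> seq V) (x0 : V) (t1 : S).
Hypothesis ord_pi : ordering pi.
Hypothesis nE : nmem s0 aN 0 = n.
Hypothesis kE : nmem s0 aK 0 = size pi.
Hypothesis termE : forall j, (j < size pi)%N -> nmem s0 aTerm j = code (val (nth t1 pi j)).
Hypothesis term0 : nmem s0 aTerm 0 = code (val t1).
Hypothesis nbP : adj_lists G nb s0.
Hypothesis x0E : code x0 = 0%N.

Definition allN := [:: aOutN; aOutSrc; aOutDst; aHead; aTail; aRoot; aL; aX; aI; aQ; aPar;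
  aMark; aOrder; aParent].
Definition allR := [:: rOutLen; rD; rDist; rWt].
Definition frame := framed allN allR s0.

Lemma frame_explore s s' : frame s -> framed exploreN exploreR s s' -> frame s'.
Proof.
move=> f /(framed_sub (la' := allN) (lr' := allR)) f'; apply: framed_trans f (f' _ _).
  by move=> a; rewrite !inE; do 6?[case/orP=> [/eqP->//|]]; move=> /eqP->.
by move=> a; rewrite !inE => /eqP->.
Qed.

Lemma code_surj i : (i < n)%N -> exists v : V, code v = i.
Proof. by move=> lt_in; exists (enum_val (Ordinal lt_in)); rewrite /code enum_valK. Qed.

Lemma code_lt (v : V) : (code v < n)%N.
Proof. exact: ltn_ord. Qed.

Lemma clear_marksP : runs clear_marks s0 (n * 3).+2
  (fun s => frame s /\ forall v : V, nmem s aMark (code v) = 0%N).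
Proof.
pose P i s := frame s /\ forall k, (k < i)%N -> nmem s aMark k = 0%N.
apply: runs_nset_seq; apply: runs_weaken (runs_for_const (P := P) (c := 2) (leq0n n) _ _ _ _) _ _ => //.
- by move=> i s _ [[fn _] _] ei; rewrite /= ei fn // nE ltnNge.
- move=> i s _ [f h] ei; apply: runs_nset_seq; apply: runs_nset => /=.
  rewrite !(upd_same, upd_array) //= ei; split=> //; split.
    by do 2! [apply: framed_nset => //].
  move=> k; rewrite ltnS leq_eqVlt /upd /=; case: eqP => //= _; exact: h.
- by split=> //; apply: framed_nset.
- by move=> s [f h]; split=> // v; apply: h; apply: code_lt.
Qed.

Record ordered (q : seq V) (par : V -> V) (s : store R) : Prop := Ordered {
  od_frame : frame s;
  od_rooted : rooted G q par;
  od_queue : forall k, (k < n)%N -> nmem s aQ k = code (nth x0 q k);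
  od_par : forall v, (0 < index v q)%N -> nmem s aPar (code v) = code (par v);
  od_dist : forall v, rmem s rDist (code v) = d x0 v;
  od_wt : forall v, (0 < index v q)%N -> d x0 v = d x0 (par v) + gwt G v (par v) }.

(** Any root serves for the distance passes and for listing the crossing edges; the machine takes
    the vertex of code 0. *)
Lemma explore_rootP s : frame s -> (forall v : V, nmem s aMark (code v) = 0%N) ->
  nmem s aRoot 0 = 0%N ->
  runs (explore (BLe (NLit 0) (NLit 0))) s (\sum_v 8 * (degree G v).+1)%N.+2.+4
    (fun s' => exists q par, ordered q par s').
Proof.
move=> fs ms rs.
have nbs : adj_lists G nb s by apply: adj_lists_framed fs nbP.
have ex : explored G s x0 predT =i predT.
  move=> v; rewrite [RHS]inE inE; have /connectP[p] := conn x0 v.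
  elim/last_ind: p v => [|p y IH] v; first by move=> _ ->; apply: connect0.
  rewrite rcons_path last_rcons => /andP[xp py] ->.
  have [->|yx] := eqVneq y x0; first exact: connect0.
  apply: connect_trans (IH _ xp erefl) (connect1 _).
  by rewrite py !inE yx ms eqxx.
have acc s' y : framed exploreN exploreR s s' ->
    nmem s' aNbr (nmem s' aL 0) = code y ->
    rmem s' rDist (nmem s' aX 0) + rmem s' rLen (nmem s' aL 0) = d x0 y ->
    beval s' (BLe (NLit 0) (NLit 0)) = predT y by [].
apply: runs_weaken (explore_spec treeG nbs acc _) _ _; first by rewrite rs x0E.
  rewrite !ltnS /explore_cost; apply: eq_leq; apply: eq_bigl => v.
  by rewrite ex.
move=> s' [q H eq].
have qq v : v \in q by rewrite -eq ex.
have sq : size q = n.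
  by rewrite -(card_uniqP (qi_uniq H)); apply: eq_card => v; rewrite qq.
have parP v : exists p, (0 < index v q)%N -> [/\ (index p q < index v q)%N, gadj G v p,
    nmem s' aPar (code v) = code p & d x0 v = d x0 p + gwt G v p].
  have [_|v0] := posnP (index v q); first by exists v.
  have [|j [jv adj e ew]] := qi_par H (k := index v q); first by rewrite v0 index_mem qq.
  rewrite !nth_index // in adj e ew; exists (nth x0 q j) => _; split=> //.
    by rewrite index_uniq ?(qi_uniq H) // (ltn_trans jv) // index_mem.
  by rewrite -ew gwt_sym.
have [par parE] := boolp.choice parP.
exists q, par; split.
- exact: frame_explore fs (qi_framed H).
- by split=> //; [exact: qi_uniq H|move=> v /parE[]].
- by move=> k kn; rewrite (qi_queue H) // sq.
- by move=> v /parE[].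
- by move=> v; rewrite (qi_dist H).
- by move=> v /parE[].
Qed.

Section Ordered.
Variables (q : seq V) (par : V -> V).
Local Notation idx := (index^~ q).

Record tree_mem (s : store R) : Prop := TreeMem {
  tm_frame : frame s;
  tm_rooted : rooted G q par;
  tm_order : forall k, (k < n)%N -> nmem s aOrder k = code (nth x0 q k);
  tm_parent : forall v, (0 < idx v)%N -> nmem s aParent (code v) = code (par v);
  tm_wt : forall v, (0 < idx v)%N -> rmem s rWt (code v) = gwt G v (par v) }.

Lemma save_orderP s : ordered q par s -> runs save_order s (n * 7).+2
  (fun s' => [/\ tree_mem s', forall v : V, nmem s' aMark (code v) = 0%N
    & forall v : V, rmem s' rD (code v) = d x0 v + d x0 (val t1)]).
Proof.
(* At the root [aPar] is arbitrary, so parent and weight are specified for the other vertices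
   only. *)
pose P i s := [/\ ordered q par s, forall k, (k < i)%N -> nmem s aOrder k = code (nth x0 q k),
  forall v : V, (code v < i)%N -> nmem s aMark (code v) = 0%N /\
     rmem s rD (code v) = d x0 v + d x0 (val t1)
  & forall v : V, (code v < i)%N -> (0 < idx v)%N ->
     nmem s aParent (code v) = code (par v) /\ rmem s rWt (code v) = gwt G v (par v)].
move=> os.
apply: runs_nset_seq; apply: runs_weaken (runs_for_const (P := P) (c := 6) (leq0n n) _ _ _ _) _ _ => //.
- by move=> i s' _ [o _ _ _] ei; rewrite /= ei (proj1 (od_frame o)) // nE ltnNge.
- move=> i s' /andP[_ lt_in] [o h1 h2 h3] ei; have [v vi] := code_surj lt_in.
  do 2 apply: runs_rset_seq; do 3 apply: runs_nset_seq; apply: runs_nset.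
  rewrite /= !(upd_same, upd_array) //= ei; split=> //.
  rewrite !(proj1 (od_frame o) aTerm) // term0 -vi !(od_dist o).
  have cuv (u : V) : (code u < (code v).+1)%N = (u == v) || (code u < code v)%N.
    by rewrite ltnS leq_eqVlt code_eq.
  split.
  + have [f r a1 a2 a3 a4] := o; split=> //=.
    by do ? [apply: framed_nset => //|apply: framed_rset => //].
  + move=> k; rewrite ltnS leq_eqVlt /upd /=; case: eqP => [->|_] /= ki.
      by rewrite (od_queue o) // vi.
    by apply: h1; rewrite -vi.
  + move=> u; rewrite cuv /upd /= code_eq; case: eqP => [->//|_ /= uv].
    by apply: h2; rewrite -vi.
  + move=> u; rewrite cuv /upd /= code_eq; case: eqP => [->|_ /= uv] => [_ v0|]; last first.
      by apply: h3; rewrite -vi.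
    by rewrite (od_par o) // (od_dist o) (od_wt o v0); split=> //; lra.
- split=> //; have [f r a1 a2 a3 a4] := os; split=> //=; exact: framed_nset.
- move=> s' [o h1 h2 h3]; split.
  + by split=> //; [exact: od_frame o|exact: od_rooted o|..] => v v0;
      have [] := h3 v (code_lt v) v0.
  + by move=> v; have [] := h2 v (code_lt v).
  + by move=> v; have [] := h2 v (code_lt v).
Qed.

Lemma mark_terminalsP s : tree_mem s -> (forall v : V, nmem s aMark (code v) = 0%N) ->
  (forall v : V, D v <= rmem s rD (code v)) ->
  runs mark_terminals s (size pi * 4).+2
  (fun s' => [/\ tree_mem s',
     forall v : V, nmem s' aMark (code v) = if v \in K then (code v).+1 else 0%N,
     forall v : V, D v <= rmem s' rD (code v)
   & forall v : V, v \in K -> rmem s' rD (code v) <= 0]).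
Proof.
pose T i := [seq val t | t <- take i pi].
have TS i : (i < size pi)%N -> T i.+1 = rcons (T i) (val (nth t1 pi i)).
  by move=> ip; rewrite /T (take_nth t1 ip) map_rcons.
have TK v : (v \in T (size pi)) = (v \in K).
  rewrite /T take_size; apply/mapP/idP => [[t _ ->]|vK]; first exact: valP t.
  by exists (Sub v vK : S); rewrite ?(proj2 ord_pi).
pose P i s := [/\ tree_mem s,
  forall v : V, nmem s aMark (code v) = if v \in T i then (code v).+1 else 0%N,
  forall v : V, D v <= rmem s rD (code v)
  & forall v : V, v \in T i -> rmem s rD (code v) <= 0].
move=> os hm hD.
apply: runs_nset_seq; apply: runs_weaken (runs_for_const (P := P) (c := 3) (leq0n (size pi)) _ _ _ _) _ _ => //.
- by move=> i s' _ [o _ _ _] ei; rewrite /= ei (proj1 (tm_frame o)) // kE ltnNge.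
- move=> i s' /andP[_ ip] [o h1 h2 h3] ei; set v := val (nth t1 pi i).
  have vK : v \in K by apply: valP.
  apply: runs_rset_seq; apply: runs_nset_seq; apply: runs_nset.
  rewrite /= !(upd_same, upd_array) //= ei; split=> //.
  rewrite !(proj1 (tm_frame o) aTerm) // termE // -/v; split.
  + have [f r a1 a2 a3] := o; split=> //=.
    by do ? [apply: framed_nset => //|apply: framed_rset => //].
  + move=> u; rewrite (TS _ ip) mem_rcons inE /upd /= code_eq -/v.
    by case: eqP => [->//|_]; rewrite h1.
  + move=> u; rewrite /upd /= code_eq; case: eqP => [->|//].
    by rewrite rtdist_term.
  + move=> u; rewrite (TS _ ip) mem_rcons inE /upd /= code_eq -/v.
    by case: eqP => [->//|_ /h3].
- split=> //=; last by move=> v; rewrite /T take0.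
    have [f r a1 a2 a3] := os; split=> //=; exact: framed_nset.
  by move=> v; rewrite /T take0 upd_array.
- move=> s' [o h1 h2 h3]; split=> // v; first by rewrite h1 TK.
  by rewrite -TK; apply: h3.
Qed.

(** The stored values bound [D] from above, and relaxation keeps this true because [D] changes along
    an edge by at most its weight. *)
Record dist_inv (s : store R) : Prop := DistInv {
  di_tree : tree_mem s;
  di_mark : forall v : V, nmem s aMark (code v) = if v \in K then (code v).+1 else 0%N;
  di_ge : forall v : V, D v <= rmem s rD (code v);
  di_term : forall v : V, v \in K -> rmem s rD (code v) <= 0 }.

Lemma rooted_size s : tree_mem s -> size q = n.
Proof.
move=> /tm_rooted[uq qq _]; rewrite -(card_uniqP uq).
by apply: eq_card => v; rewrite qq.
Qed.

Lemma index_order s i : tree_mem s -> (i < n)%N -> index (nth x0 q i) q = i.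
Proof. by move=> o lt_in; have [uq _ _] := tm_rooted o; rewrite index_uniq ?(rooted_size o). Qed.

Lemma index_lt s v : tree_mem s -> (idx v < n)%N.
Proof. by move=> o; rewrite -(rooted_size o) index_mem; have [_ -> _] := tm_rooted o. Qed.

Lemma curE s i : tree_mem s -> nmem s aI 0 = i -> (i < n)%N ->
  neval s cur = code (nth x0 q i).
Proof. by move=> o ei lt_in; rewrite /= ei (tm_order o). Qed.

Lemma cur_parentE s i : tree_mem s -> nmem s aI 0 = i -> (0 < i < n)%N ->
  neval s cur_parent = code (par (nth x0 q i)).
Proof.
move=> o ei /andP[i0 lt_in]; rewrite -[LHS]/(nmem s aParent (neval s cur)) (curE o ei lt_in).
by rewrite (tm_parent o) // (index_order o).
Qed.

Lemma curWE s i : tree_mem s -> nmem s aI 0 = i -> (0 < i < n)%N ->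
  reval s (RGet rWt cur) = gwt G (nth x0 q i) (par (nth x0 q i)).
Proof.
move=> o ei /andP[i0 lt_in]; rewrite -[LHS]/(rmem s rWt (neval s cur)) (curE o ei lt_in).
by rewrite (tm_wt o) // (index_order o).
Qed.

Lemma tree_mem_setI s x : tree_mem s -> tree_mem (Store (upd (nmem s) aI 0 x) (rmem s)).
Proof. by move=> o; have [f r a1 a2 a3] := o; split=> //=; apply: framed_nset. Qed.

Lemma dist_inv_setI s x : dist_inv s -> dist_inv (Store (upd (nmem s) aI 0 x) (rmem s)).
Proof. by move=> [o h1 h2 h3]; split=> //=; apply: tree_mem_setI. Qed.

Lemma relaxP s i x y a b : dist_inv s -> nmem s aI 0 = i -> (0 < i < n)%N ->
  neval s x = code a -> neval s y = code b -> gadj G a b ->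
  gwt G a b = gwt G (nth x0 q i) (par (nth x0 q i)) ->
  runs (relax x y) s 2 (fun s' => [/\ dist_inv s', nmem s' aI 0 = i,
    forall u, u != b -> rmem s' rD (code u) = rmem s rD (code u),
    rmem s' rD (code b) <= rmem s rD (code b) /\
    rmem s' rD (code b) <= rmem s rD (code a) + gwt G a b
    & rmem s' rD (code b) = rmem s rD (code b) \/
      rmem s' rD (code b) = rmem s rD (code a) + gwt G a b]).
Proof.
move=> H ei i_n ea eb ab wab; have o := di_tree H.
have wE := curWE o ei i_n; rewrite -wab in wE.
have tE : reval s (RAdd (RGet rD x) (RGet rWt cur)) = rmem s rD (code a) + gwt G a b.
  by rewrite /= -/(reval s (RGet rWt cur)) wE ea.
have bE : beval s (BLeR (RAdd (RGet rD x) (RGet rWt cur)) (RGet rD y)) =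
    (rmem s rD (code a) + gwt G a b <= rmem s rD (code b)) by rewrite -tE -eb.
apply: runs_if; rewrite bE.
case: leP => [le|/ltW lt]; last by apply: runs_skip; split=> //; left.
apply: runs_rset; rewrite tE eb; split=> //=.
- have [[f r a1 a2 a3] h1 h2 h3] := H; split=> //=.
  + split=> //=; exact: framed_rset.
  + move=> v; rewrite /upd /= code_eq; case: eqP => [->|//].
    have ba : gadj G b a by rewrite gadj_sym.
    have := h2 a.
    have := rtdist_step conn (valP t1) ba; rewrite (gwt_sym G b a); lra.
  + move=> v vK; rewrite /upd /= code_eq; case: eqP => [e|_]; last exact: h3.
    by apply: le_trans le _; rewrite -e; apply: h3.
- by move=> u ub; rewrite /upd /= code_eq (negbTE ub).
- by rewrite upd_same.
- by right; rewrite upd_same.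
Qed.

(** A step changes only the value at [par v], which precedes [v] in the order. In the inequalities
    already established this value occurs only on the parent side, where a decrease does no harm. *)
Lemma relax_upP s : dist_inv s -> runs relax_up s (n * 4).+2
  (fun s' => dist_inv s' /\ forall v, (0 < idx v)%N ->
     rmem s' rD (code (par v)) <= rmem s' rD (code v) + gwt G v (par v)).
Proof.
move=> H0; pose up i s := forall v, (0 < idx v)%N -> (i <= idx v)%N ->
  rmem s rD (code (par v)) <= rmem s rD (code v) + gwt G v (par v).
pose I k s := exists i, [/\ (0 < i <= n)%N, dist_inv s, nmem s aI 0 = i, up i s & k = (i * 4)%N].
apply: runs_nset_seq; rewrite /= (proj1 (tm_frame (di_tree H0))) // nE.
have n0 : (0 < n)%N by apply: leq_ltn_trans (code_lt x0).
apply: runs_weaken (@runs_while _ I _ _ _ _ _ _) (leqnn _) _.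
- move=> k s1 [i [/andP[i0 le_in] H ei U ->]].
  rewrite /= ei -ltnNge => i1; exists 3.
  have H1 := dist_inv_setI i.-1 H; have i_n : (0 < i.-1 < n)%N by lia.
  have e1 : nmem (Store (upd (nmem s1) aI 0 i.-1) (rmem s1)) aI 0 = i.-1 by [].
  have o1 := di_tree H1; set v := nth x0 q i.-1.
  have vi : idx v = i.-1 by rewrite (index_order o1) //; case/andP: i_n.
  have v0 : (0 < idx v)%N by rewrite vi; case/andP: i_n.
  have i_lt : (i.-1 < n)%N by case/andP: i_n.
  have [uq qq parP] := tm_rooted o1; have [lt_pv vp] := parP v v0.
  apply: runs_nset_seq; rewrite /= ei.
  apply: runs_weaken (relaxP H1 e1 i_n (curE o1 e1 i_lt) (cur_parentE o1 e1 i_n) vp erefl) (leqnn _) _.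
  move=> s2 [H2 e2 same [ni le_p] _]; exists (i.-1 * 4)%N; last by lia.
  exists i.-1; split=> //; first by lia.
  have vpar (u : V) : (i.-1 <= idx u)%N -> u != par v.
    by move=> iu; apply/eqP => e; move: lt_pv; rewrite -e vi ltnNge iu.
  move=> u u0; rewrite leq_eqVlt => /orP[/eqP iu|iu].
    have -> : u = v by rewrite -(nth_index x0 (qq u)) -iu -/v.
    by rewrite (same v) // vpar // vi.
  have iu' : (i <= idx u)%N by rewrite -ltnS -(ltn_predK i1) in iu *.
  rewrite (same u (vpar u (ltnW iu))); have := U u u0 iu' => /= Uu.
  have [pe|pne] := eqVneq (par u) (par v); last by rewrite same.
  by rewrite pe in Uu *; apply: le_trans ni Uu.
- exists n; split=> //; [by rewrite n0 leqnn|exact: dist_inv_setI|].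
  by move=> v _; rewrite leqNgt (index_lt _ (di_tree H0)).
move=> s1 [[k [i [/andP[i0 _] H ei U _]]]] /=; rewrite ei negbK => i1.
by split=> // v v0; apply: U => //; apply: leq_trans i1 v0.
Qed.

(** Lowering the value at [v] keeps the upward inequality of its own edge because the weight is
    non-negative, and those of its children because only their parent side decreases. In the end
    both inequalities hold on every parent edge, so [lipschitz_le_dist] bounds the stored values by
    [D]; the invariant gives the converse. *)
Lemma relax_downP s : dist_inv s ->
  (forall v, (0 < idx v)%N ->
     rmem s rD (code (par v)) <= rmem s rD (code v) + gwt G v (par v)) ->
  runs relax_down s (n * 4).+2
  (fun s' => [/\ tree_mem s',
    forall v : V, nmem s' aMark (code v) = if v \in K then (code v).+1 else 0%N
    & forall v : V, rmem s' rD (code v) = D v]).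
Proof.
move=> H0 U0.
pose up s := forall v, (0 < idx v)%N ->
  rmem s rD (code (par v)) <= rmem s rD (code v) + gwt G v (par v).
pose dn i s := forall v, (0 < idx v)%N -> (idx v < i)%N ->
  rmem s rD (code v) <= rmem s rD (code (par v)) + gwt G v (par v).
pose P i s := [/\ dist_inv s, up s & dn i s].
have n0 : (0 < n)%N by apply: leq_ltn_trans (code_lt x0).
apply: runs_nset_seq; apply: runs_weaken (runs_for_const (P := P) (c := 3) n0 _ _ _ _) _ _ => //.
- by move=> i s' _ [[o _ _ _] _ _] ei; rewrite /= ei (proj1 (tm_frame o)) // nE ltnNge.
- move=> i s1 i_n [H U Dn] ei; have [i0 i_lt] := andP i_n.
  have o := di_tree H; set v := nth x0 q i; have vi : idx v = i by rewrite (index_order o).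
  have v0 : (0 < idx v)%N by rewrite vi.
  have [uq qq parP] := tm_rooted o; have [lt_pv vp] := parP v v0.
  have pvv : par v != v by apply/eqP => e; rewrite e ltnn in lt_pv.
  have pv : gadj G (par v) v by rewrite gadj_sym.
  apply: (@runs_seq _ _ _ _ 2 1).
  apply: runs_weaken (relaxP H ei i_n (cur_parentE o ei i_n) (curE o ei i_lt) pv (gwt_sym _ _ _))
    (leqnn _) _.
  move=> s2 [H2 e2 same [ni le_v] cases]; apply: runs_nset; rewrite /= e2; split=> //.
  split; first exact: dist_inv_setI.
    move=> u u0 /=; have [-> | uv] := eqVneq u v.
      rewrite (same _ pvv); case: cases => ->; first exact: U.
      by rewrite (gwt_sym G (par v)); have := gwt_ge0 vp; lra.
    rewrite (same u uv); apply: le_trans (U u u0).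
    by have [->|/same->] := eqVneq (par u) v.
  move=> u u0; rewrite ltnS leq_eqVlt => /orP[/eqP ui|ui] /=.
    have -> : u = v by rewrite -(nth_index x0 (qq u)) ui.
    by rewrite (same _ pvv); apply: le_trans le_v _; rewrite gwt_sym.
  have uv : u != v by apply/eqP => e; rewrite e vi ltnn in ui.
  have puv : par u != v.
    apply/eqP => e; have [lt_pu _] := parP u u0; move: (ltn_trans lt_pu ui).
    by rewrite e vi ltnn.
  by rewrite (same u uv) (same _ puv); apply: Dn.
- split; [exact: dist_inv_setI|exact: U0|].
  by move=> v v0 v1; move: (leq_trans v1 v0); rewrite ltnn.
move=> s1 [H U Dn]; have o := di_tree H; split; [exact: o|exact: di_mark H|].
move=> v; apply/le_anti; rewrite (di_ge H) andbT.
have [s' s'K ->] := rtdist_attained conn v (valP t1).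
pose f (v : V) := rmem s1 rD (code v).
have lip : forall u w, gadj G u w -> f u <= f w + gwt G u w.
  apply: (rooted_lipschitz treeG (tm_rooted o)) => w w0; last exact: U.
  by apply: Dn; rewrite ?(index_lt _ o).
have := lipschitz_le_dist treeG lip v s'; have := di_term H s'K; rewrite /f; lra.
Qed.

Variable C : S -> {set V}.
Hypothesis grvC : grv G (fun=> 3) pi C.
Variable cl : V -> S.
Hypothesis clP : forall v, v \in C (cl v).

Lemma clusteredS v i : (i < size pi)%N ->
  (v \in clustered C (take i.+1 pi)) =
  (v \in C (nth t1 pi i)) || (v \in clustered C (take i pi)).
Proof. by move=> ip; rewrite !inE (take_nth t1 ip) has_rcons. Qed.

Lemma sum_clusters (F : V -> nat) :
  (\sum_(0 <= i < size pi) \sum_(v in C (nth t1 pi i)) F v = \sum_v F v)%N.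
Proof.
have [upi mem_pi] := ord_pi.
rewrite -(big_nth t1 predT (fun t => \sum_(v in C t) F v)%N).
rewrite (perm_big (index_enum S)) /=; last first.
  apply: uniq_perm => //; [exact: index_enum_uniq|move=> t; rewrite mem_pi mem_index_enum //].
rewrite (exchange_big_dep predT) //=; apply: eq_bigr => v _.
apply: (big_pred1 (cl v)) => t /=; apply/idP/eqP => [vt|->]; last exact: clP.
exact: (cluster_uniq treeG ord_pi grvC vt (clP v)).
Qed.

Lemma size_pi : (size pi <= n)%N.
Proof.
rewrite -(size_map val pi) -(card_uniqP _) ?max_card // map_inj_uniq; last exact: val_inj.
by case: ord_pi.
Qed.

(** Terminals are marked in advance, so the unmarked vertices are those outside [K] and the earlier
    clusters, just as in the algorithm. As the clusters partition the vertices, the costs of the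
    searches add up to a single sum over [V]. *)
Lemma grow_clustersP s : tree_mem s ->
  (forall v : V, nmem s aMark (code v) = if v \in K then (code v).+1 else 0%N) ->
  (forall v : V, rmem s rD (code v) = D v) ->
  runs grow_clusters s (size pi * 9 + \sum_v 8 * (degree G v).+1)%N.+2
  (fun s' => [/\ tree_mem s',
    forall v : V, nmem s' aMark (code v) = (code (val (cl v))).+1
    & forall v : V, rmem s' rDist (code v) = d (val (cl v)) v]).
Proof.
move=> o0 m0 D0.
have [upi mem_pi] := ord_pi.
have cl_eq v t : v \in C t -> cl v = t.
  by move=> vt; apply: (cluster_uniq treeG ord_pi grvC (clP v) vt).
pose P i s := [/\ tree_mem s, forall v : V, rmem s rD (code v) = D v,
  forall v : V, nmem s aMark (code v) =
    if (v \in K) || (v \in clustered C (take i pi)) then (code (val (cl v))).+1 else 0%N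
  & forall v : V, v \in clustered C (take i pi) -> rmem s rDist (code v) = d (val (cl v)) v].
pose f i := (\sum_(v in C (nth t1 pi i)) 8 * (degree G v).+1)%N.+4.+4.
apply: runs_nset_seq; apply: runs_weaken (runs_for (P := P) (f := f) (leq0n (size pi)) _ _ _ _) _ _ => //.
- by move=> i s' _ [o _ _ _] ei; rewrite /= ei (proj1 (tm_frame o)) // kE ltnNge.
- move=> i s' /andP[_ ip] [o h1 h2 h3] ei; set t := nth t1 pi i.
  have ti : index t pi = i by rewrite index_uniq.
  have tE : neval s' (NGet aTerm aI%v) = code (val t).
    by rewrite /= ei (proj1 (tm_frame o)) // termE.
  rewrite /f -/t; apply: runs_nset_seq; rewrite tE.
  set s1 := Store _ _.
  have o1 : tree_mem s1.
    by have [g r a1 a2 a3] := o; split=> //=; apply: framed_nset.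
  have nb1 : adj_lists G nb s1 by apply: adj_lists_framed (tm_frame o1) nbP.
  have acc1 s2 y : framed exploreN exploreR s1 s2 ->
      nmem s2 aNbr (nmem s2 aL 0) = code y ->
      rmem s2 rDist (nmem s2 aX 0) + rmem s2 rLen (nmem s2 aL 0) = d (val t) y ->
      beval s2 accept3 = accepts G K (val t) 3 y.
    move=> [_ fr] ey ed; rewrite /= ed ey !fr // h1 (acceptsE conn) ?(valP t) // rdistC.
    by congr (_ <= _); lra.
  have ex : explored G s1 (val t) (accepts G K (val t) 3) = C t.
    rewrite ((@grvE R V G K (fun=> 3) pi C ord_pi).1 grvC t) ti; apply/setP => v; rewrite [LHS]inE [RHS]inE.
    apply: eq_connect => x y; rewrite /grow_rel; congr [&& _, _ & _].
    rewrite in_setD1 in_setD in_setC inE [nmem _ _ _]h2.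
    case: (boolP (y \in K)) => yK /=; first by rewrite andbF andbF.
    have -> /= : y != val t by apply: contraNneq yK => ->; apply: valP.
    by rewrite andbT; case: ifP.
  have cost : explore_cost G s1 (val t) (accepts G K (val t) 3) =
      (\sum_(v in C t) 8 * (degree G v).+1)%N by rewrite /explore_cost ex.
  have r1 := explore_spec treeG nb1 acc1 (upd_same _ _ _ _); rewrite cost ex in r1.
  have r2 : runs (Seq (explore accept3) incr) s1
      ((\sum_(v in C t) 8 * (degree G v).+1).+2.+4 + 1)%N (fun s' => P i.+1 s' /\ nmem s' aI 0 = i.+1).
    apply: runs_seq; apply: runs_weaken r1 (leqnn _) _ => s2 [q' H eq].
    have [fn fr] := qi_framed H; apply: runs_nset.
    have ei2 : nmem s2 aI 0 = i by rewrite fn // upd_array.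
    rewrite /= ei2; split=> //; split=> /=.
    + have [g r a1 a2 a3] := o1; split=> //=.
      * by apply: framed_nset => //; apply: frame_explore g (qi_framed H).
      * by move=> k kn; rewrite upd_array // fn // a1.
      * by move=> v v0; rewrite upd_array // fn // a2.
      * by move=> v v0; rewrite fr // a3.
    + by move=> v; rewrite fr // h1.
    + move=> v; rewrite upd_array // (qi_mark H) -eq clusteredS // -/t.
      case: (boolP (v \in C t)) => [vt|vt]; first by rewrite orbT (cl_eq _ _ vt).
      by rewrite -[nmem s1 aMark _]/(nmem s' aMark (code v)) h2.
    + move=> v; rewrite clusteredS // -/t.
      case: (boolP (v \in C t)) => [vt _|vt vc].
        by rewrite (qi_dist H) -?eq // (cl_eq _ _ vt).
      by rewrite (qi_dist_out H) -?eq //= h3.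
  by apply: runs_weaken r2 _ _ => //; rewrite addn1.
- split=> //=.
  + by have [g r a1 a2 a3] := o0; split=> //=; apply: framed_nset.
  + move=> v; rewrite upd_array // m0 take0 inE orbF; case: ifP => // vK.
    by rewrite (cl_eq v (Sub v vK : S)) //; apply: (terminal_in_cluster ord_pi grvC (Sub v vK : S)).
  + by move=> v; rewrite take0 inE.
- rewrite !ltnS /f.
  under eq_bigr do rewrite -addn4 -addn4 -addn1 -!addnA.
  by rewrite big_split /= sum_clusters sum_nat_const_nat subn0 addnC.
have all v : v \in clustered C (take (size pi) pi).
  by rewrite take_size inE; apply/hasP; exists (cl v).
move=> s' [o h1 h2 h3]; split=> // v; first by rewrite h2 all orbT.
by rewrite h3.
Qed.

Definition emitted (E : seq V) (s : store R) : Prop :=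
  nmem s aOutN 0 = size E /\ forall k, (k < size E)%N ->
    [/\ nmem s aOutSrc k = code (val (cl (nth x0 E k))),
        nmem s aOutDst k = code (val (cl (par (nth x0 E k))))
      & rmem s rOutLen k = d (val (cl (nth x0 E k))) (nth x0 E k) +
          gwt G (nth x0 E k) (par (nth x0 E k)) +
          d (val (cl (par (nth x0 E k)))) (par (nth x0 E k))].

Record clusters_mem (s : store R) : Prop := ClustersMem {
  cm_tree : tree_mem s;
  cm_mark : forall v : V, nmem s aMark (code v) = (code (val (cl v))).+1;
  cm_dist : forall v : V, rmem s rDist (code v) = d (val (cl v)) v }.

Lemma emitP s i E : clusters_mem s -> emitted E s -> nmem s aI 0 = i -> (0 < i < n)%N ->
  runs emit s 5 (fun s' => [/\ clusters_mem s', nmem s' aI 0 = i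
    & emitted (if cl (nth x0 q i) != cl (par (nth x0 q i)) then rcons E (nth x0 q i) else E) s']).
Proof.
move=> H [eN eE] ei i_n; have o := cm_tree H; have [_ i_lt] := andP i_n.
have cE := curE o ei i_lt; have pE := cur_parentE o ei i_n; have wE := curWE o ei i_n.
set v := nth x0 q i in cE pE wE *.
have mc : neval s (NGet aMark cur) = (code (val (cl v))).+1.
  by rewrite -[LHS]/(nmem s aMark (neval s cur)) cE (cm_mark H).
have mp : neval s (NGet aMark cur_parent) = (code (val (cl (par v)))).+1.
  by rewrite -[LHS]/(nmem s aMark (neval s cur_parent)) pE (cm_mark H).
have test : beval s (BAnd (BLe (NGet aMark cur) (NGet aMark cur_parent))
           (BLe (NGet aMark cur_parent) (NGet aMark cur))) = (cl v == cl (par v)).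
  rewrite -[LHS]/((neval s (NGet aMark cur) <= neval s (NGet aMark cur_parent))%N &&
     (neval s (NGet aMark cur_parent) <= neval s (NGet aMark cur))%N).
  by rewrite mc mp !ltnS -eqn_leq code_eq.
apply: runs_if; rewrite test; case: (eqVneq (cl v)) => [_|ne] /=.
  by apply: (@runs_weaken _ _ _ 1); [apply: runs_skip|by []|by move=> s' P; exact: P].
have lenE : reval s (RAdd (RAdd (RGet rDist cur) (RGet rWt cur)) (RGet rDist cur_parent)) =
    d (val (cl v)) v + gwt G v (par v) + d (val (cl (par v))) (par v).
  rewrite -[LHS]/(rmem s rDist (neval s cur) + reval s (RGet rWt cur) +
    rmem s rDist (neval s cur_parent)).
  by rewrite cE pE wE !(cm_dist H).
rewrite /= in lenE mc mp.
do 2 apply: runs_nset_seq; apply: runs_rset_seq; apply: runs_nset.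
rewrite /= !(upd_same, upd_array) //= lenE mc mp eN /=; split.
- have [[f r a1 a2 a3] h1 h2] := H; split=> //; split=> //=.
  by do ? [apply: framed_nset => //|apply: framed_rset => //].
- by [].
split; first by rewrite size_rcons.
move=> k; rewrite size_rcons ltnS leq_eqVlt /upd /= nth_rcons.
case: (eqVneq k (size E)) => [->|_] /=; first by rewrite ltnn.
by move=> kE'; rewrite kE'; apply: eE.
Qed.

Lemma output_minorP s : clusters_mem s -> runs output_minor s (n * 7).+3
  (fun s' => emitted (crossing q par cl) s').
Proof.
move=> H0.
(* The loop starts at 1, past the root, so at counter [i] it has handled [i.-1] entries of
   [behead q]. *)
pose E i := [seq v <- take i.-1 (behead q) | cl v != cl (par v)].
pose P i s := clusters_mem s /\ emitted (E i) s.
have n0 : (0 < n)%N by apply: leq_ltn_trans (code_lt x0).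
do 2 apply: runs_nset_seq.
apply: runs_weaken (runs_for_const (P := P) (c := 6) n0 _ _ _ _) _ _ => //.
- by move=> i s' _ [[o _ _] _] ei; rewrite /= ei (proj1 (tm_frame o)) // nE ltnNge.
- move=> i s1 i_n [H eE] ei; have [i0 i_lt] := andP i_n.
  have o := cm_tree H.
  have ES : E i.+1 = if cl (nth x0 q i) != cl (par (nth x0 q i)) then rcons (E i) (nth x0 q i) else E i.
    have ib : (i.-1 < size (behead q))%N by rewrite size_behead (rooted_size o); lia.
    rewrite /E /= -{1}(prednK i0) (take_nth x0 ib) filter_rcons nth_behead prednK //.
  apply: (@runs_seq _ _ _ _ 5 1); apply: runs_weaken (emitP H eE ei i_n) (leqnn _) _.
  move=> s2 [H2 e2 E2]; apply: runs_nset; rewrite /= e2; split=> //; split.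
    have [[f r a1 a2 a3] h1 h2] := H2; split=> //; split=> //=; exact: framed_nset.
  by rewrite ES.
- split; last by rewrite /E take0.
  have [[f r a1 a2 a3] h1 h2] := H0; split=> //; split=> //=.
  by do 2! [apply: framed_nset => //].
- move=> s' [H]; rewrite /E take_oversize // size_behead (rooted_size (cm_tree H)) //.
Qed.

End Ordered.

Lemma programP : (0 < size pi)%N -> exists s' (m : nat) (C : S -> {set V}),
  [/\ exec program s0 s' m, (m <= 120 * n)%N, grv G (fun=> 3) pi C & outputs (minor G C) s'].
Proof.
move=> pi0.
have [C grvC] := grv_exists G (fun=> 3) (proj1 ord_pi).
have [cl clP] := boolp.choice (cover_cluster treeG ord_pi grvC t1).
pose Q s' := outputs (minor G C) s'.
suff [s' [m [e le_m q]]] : runs program s0 (120 * n) Q by exists s', m, C.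
pose W := (\sum_v 8 * (degree G v).+1)%N.
(* The degree bound is carried in the postcondition because it is derived from the rooted order,
   which exists only once the first search has run. *)
have body : runs (clear_marks ;; setv aRoot (NLit 0) ;; explore (BLe (NLit 0) (NLit 0)) ;;
     save_order ;; mark_terminals ;; relax_up ;; relax_down ;; grow_clusters ;;
     output_minor) s0 ((n * 3).+2 + (W.+2.+4 + ((n * 7).+2 + ((size pi * 4).+2 + ((n * 4).+2 +
       ((n * 4).+2 + ((size pi * 9 + W).+2 + (n * 7).+3)))))).+1)%N
     (fun s' => (\sum_v degree G v <= 2 * n)%N /\ Q s').
  apply: runs_seq; apply: runs_weaken clear_marksP (leqnn _) _ => s1 [f1 m1].
  apply: runs_nset_seq; apply: runs_seq.
  apply: runs_weaken (explore_rootP _ _ _) (leqnn _) _ => //.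
    exact: framed_nset.
  move=> s2 [q [par H2]].
  apply: runs_seq; apply: runs_weaken (save_orderP H2) (leqnn _) _ => s3 [o3 m3 d3].
  apply: runs_seq; apply: runs_weaken (mark_terminalsP o3 m3 _) (leqnn _) _.
    move=> v; rewrite d3; apply: le_trans (rtdist_le conn v (valP t1)) _.
    by rewrite (rdistC G x0 v); apply: rdist_triangle.
  move=> s4 [o4 m4 D4 T4]; have H4 := DistInv o4 m4 D4 T4.
  apply: runs_seq; apply: runs_weaken (relax_upP H4) (leqnn _) _ => s5 [H5 U5].
  apply: runs_seq; apply: runs_weaken (relax_downP H5 U5) (leqnn _) _ => s6 [o6 m6 D6].
  apply: runs_seq; apply: runs_weaken (grow_clustersP grvC clP o6 m6 D6) (leqnn _) _.
  move=> s7 [o7 m7 D7]; have H7 := ClustersMem o7 m7 D7.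
  apply: runs_weaken (output_minorP H7) (leqnn _) _ => s8 [eN eE].
  have rq := od_rooted H2; split; first exact: (sum_degree treeG rq).
  exists [seq (cl v, cl (par v)) | v <- crossing q par cl]; split.
    exact: (crossing_edges treeG rq ord_pi grvC clP).
  apply: (@eq_from_nth _ (0%N, 0%N, 0)); first by rewrite size_mkseq !size_map eN.
  move=> k; rewrite size_mkseq eN => kE'; rewrite nth_mkseq ?eN // -map_comp (nth_map x0) //=.
  have [-> -> ->] := eE k kE'.
  by rewrite -(crossing_wt treeG rq ord_pi grvC clP) // mem_nth.
have [s' [m [e le_m [dg q]]]] := body.
exists s', m.+1; split=> //; first by apply: exec_if; rewrite /= kE leqNgt pi0.
have We : W = (8 * \sum_v degree G v + 8 * n)%N.
  rewrite /W -big_distrr /= -mulnDr -sum1_card -big_split /=; congr (_ * _)%N.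
  by apply: eq_bigr => v _; rewrite addn1.
have n0 : (0 < n)%N by apply: leq_ltn_trans (code_lt x0).
(* Each [W] is at most [24 n] and occurs twice; the other loops cost at most [38 n], and 23 single
   steps remain. The total [86 n + 23] is at most [120 n] because [n >= 1]. *)
have := size_pi; move: le_m dg n0; rewrite We; clear.
move: (size pi) (\sum_v degree G v)%N n => a b c; lia.
Qed.

End Program.

Lemma empty_programP (R : realType) (V : finType) (G : wgraph R V) (K : {set V})
    (s0 : store R) : nmem s0 aK 0 = 0%N -> K = finset.set0 ->
  exists s' m, [/\ exec program s0 s' m, (m <= 2)%N
    & forall C, outputs (minor G C : wgraph R {t : V | t \in K}) s'].
Proof.
move=> k0 K0; have none : {t : V | t \in K} -> False.
  by move=> [t]; rewrite K0 inE.
exists (Store (upd (nmem s0) aOutN 0 0%N) (rmem s0)), 2; split=> //.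
  by apply: exec_if; rewrite /= k0; apply: exec_nset.
move=> C; exists [::]; split; last by rewrite /= upd_same.
rewrite (_ : enum _ = [::]) //; apply/eqP; rewrite -size_eq0 -cardE cards_eq0.
by apply/eqP/setP => X; rewrite inE; apply/negP => /imsetP[[t t'] _ _]; exact: none t.
Qed.

(** The permutation is extracted as a list of positions, so that it reorders the vertices
    themselves; codes and weights then follow the same reordering. *)
Lemma adj_lists_exist (R : realType) (V : finType) (G : wgraph R V) (K : {set V}) pi s :
  @encodes R V G K pi s -> exists nb, adj_lists G nb s.
Proof.
move=> [_ _ _ [_ mono] H].
suff : forall v : V, exists l, [/\ perm_eq l (enum (gadj G v)),
    nmem s aOff (code v).+1 = (nmem s aOff (code v) + size l)%N
    & forall k, (k < size l)%N ->
      nmem s aNbr (nmem s aOff (code v) + k) = code (nth v l k) /\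
      rmem s rLen (nmem s aOff (code v) + k) = gwt G v (nth v l k)].
  by move=> /boolp.choice[nb nbP]; exists nb.
move=> v; have le_off : (nmem s aOff (code v) <= nmem s aOff (code v).+1)%N.
  exact/mono/ltn_ord.
have /(perm_iotaP (0%N, 0))[Is pI e] := H v.
rewrite /index_iota in e; rewrite size_map in pI.
have Is_lt i : i \in Is -> (i < size (enum (gadj G v)))%N.
  by rewrite (perm_mem pI) mem_iota.
exists [seq nth v (enum (gadj G v)) i | i <- Is]; split.
- by apply/(perm_iotaP v); exists Is.
- move/(congr1 size): (e); rewrite !size_map size_iota => <-.
  by rewrite subnKC.
move=> k; rewrite size_map => kI.
have kd : (k < nmem s aOff (code v).+1 - nmem s aOff (code v))%N.
  by move/(congr1 size): (e); rewrite !size_map size_iota => ->.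
have Isk : (nth 0%N Is k < size (enum (gadj G v)))%N by apply: Is_lt; apply: mem_nth.
have := congr1 (fun l => nth (0%N, 0) l k) e.
rewrite (nth_map 0%N (0%N, 0) _ (n := k) (s := Is)) // (nth_map v (0%N, 0) _ Isk).
rewrite (nth_map 0%N (0%N, 0)) ?size_iota // nth_iota // => -[-> ->].
by rewrite (nth_map 0%N).
Qed.

Theorem theorem1 (R : realType) :
  (forall (V : finType) (T : wgraph R V) (K : {set V}) (r : V)
      (pi : seq {t : V | t \in K}) (C : {t : V | t \in K} -> {set V}),
    is_tree T -> ordered_from T r pi -> grv T (fun=> 3) pi C ->
    forall t t' : {t : V | t \in K}, t != t' ->
      (dist T (val t) (val t') <= dist (minor T C) t t')%E /\
      (dist (minor T C) t t' <= 8%:E * dist T (val t) (val t'))%E) /\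
  (exists (P : com) (c : nat),
    forall (V : finType) (T : wgraph R V) (K : {set V}) (r : V)
      (pi : seq {t : V | t \in K}) (s : store R),
    is_tree T -> ordered_from T r pi -> encodes T pi s ->
    exists (s' : store R) (m : nat) (C : {t : V | t \in K} -> {set V}),
      [/\ exec P s s' m, (m <= c * gsize T)%N,
          grv T (fun=> 3) pi C & outputs (minor T C) s']).
Proof.
split; first exact: grv_distortion.
exists program, 120 => V T K r pi s treeT [ord_pi _] enc.
have [nE kE termE _ _] := enc; have [nb nbP] := adj_lists_exist enc.
have V0 : (0 < #|V|)%N by apply/card_gt0P; exists r.
have le_size : (120 * #|V| <= 120 * gsize T)%N by rewrite leq_mul2l leq_addr orbT.
case: (posnP (size pi)) => [pi0|pi0].
  have K0 : K = finset.set0.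
    apply/setP => v; rewrite inE; apply/negP => vK.
    by have := proj2 ord_pi (Sub v vK); rewrite (size0nil pi0).
  have [|s' [m [e le_m out]]] := @empty_programP R V T K s _ K0; first by rewrite kE.
  exists s', m, (fun=> finset.set0); split=> //; last by rewrite (size0nil pi0).
  by apply: leq_trans le_m (leq_trans _ le_size); lia.
have [t1 [pi' epi]] : exists t1 pi', pi = t1 :: pi'.
  by case: (pi) pi0 => // t1 pi' _; exists t1, pi'.
have termE' j : (j < size pi)%N -> nmem s aTerm j = code (val (nth t1 pi j)).
  by move=> jp; rewrite -(nth_mkseq 0%N (nmem s aTerm) jp) termE (nth_map t1).
have term0 : nmem s aTerm 0 = code (val t1) by rewrite termE' // epi.
have [x0 x0E] := code_surj V0.
have [s' [m [C [e le_m gC out]]]] := programP treeT ord_pi nE kE termE' term0 nbP x0E pi0.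
by exists s', m, C; split=> //; apply: leq_trans le_m le_size.
Qed.
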